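(* Let $\mathcal{U}$ be the set of 19 Wang tiles given in the context and let $\Omega_{\mathcal{U}}$ be its Wang shift. There exists a cut and project scheme such that for every configuration $w\in\Omega_{\mathcal{U}}$, the set $Q\subseteq\mathbb{Z}^2$ of occurrences of a pattern in $w$ is a regular model set. If $w$ is a generic (resp. singular) configuration, then $Q$ is a generic (resp. singular) model set.
   Context: Wang shifts. A Wang tile is a quadruple $\tau=(a,b,c,d)$ = (right, top, left, bottom) colors. For a finite set $\mathcal{T}$ of Wang tiles, the Wang shift $\Omega_{\mathcal{T}}\subset\mathcal{T}^{\mathbb{Z}^2}$ is the set of all $x:\mathbb{Z}^2\to\mathcal{T}$ such that for all $n$: right color of $x_{n}$ = left color of $x_{n+(1,0)}$ and top color of $x_n$ = bottom color of $x_{n+(0,1)}$. The tiles $\mathcal{U}=\{u_0,\dots,u_{18}\}$ (right, top, left, bottom): $u_0=(F,O,J,O)$, $u_1=(F,O,H,L)$, $u_2=(J,M,F,P)$, $u_3=(D,M,F,K)$, $u_4=(H,P,J,P)$, $u_5=(H,P,H,N)$, $u_6=(H,K,F,P)$, $u_7=(H,K,D,P)$, $u_8=(B,O,I,O)$, $u_9=(G,L,E,O)$, $u_{10}=(G,L,C,L)$, $u_{11}=(A,L,I,O)$, $u_{12}=(E,P,G,P)$, $u_{13}=(E,P,I,P)$, $u_{14}=(I,P,G,K)$, $u_{15}=(I,P,I,K)$, $u_{16}=(I,K,B,M)$, $u_{17}=(I,K,A,K)$, $u_{18}=(C,N,I,P)$. The partition $\mathcal{P}_{\mathcal{U}}$.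 Let $\varphi=\frac{1+\sqrt5}{2}$, $\alpha=\varphi^{-2}=2-\varphi$, $\mathbb{T}^2=\mathbb{R}^2/\mathbb{Z}^2$, and $R_{\mathcal{U}}^{n}(x)=x+\varphi^{-2}n$ on $\mathbb{T}^2$ for $n\in\mathbb{Z}^2$. Let $\mathcal{Y}=\{Y_i\}$, $i\in\{A,\dots,J\}$, and $\mathcal{Z}=\{Z_j\}$, $j\in\{K,\dots,P\}$, be the topological partitions of $\mathbb{T}^2$ whose atoms are the images of the interiors of the following polygons in $[0,1]^2$ (vertices in order). $Y_A$: $(0,2\alpha),(\alpha,\alpha),(0,1)$. $Y_B$: $(0,\alpha),(\alpha,\alpha),(0,2\alpha)$. $Y_C$: $(2\alpha,1),(1,2\alpha),(1,1)$. $Y_D$: $(\alpha,0),(1-\alpha,0),(\alpha,\alpha)$. $Y_E$: $(1,\alpha),(1,2\alpha),(2\alpha,1),(1-\alpha,1)$. $Y_F$: $(0,0),(\alpha,0),(\alpha,\alpha),(0,\alpha)$. $Y_G$: $(\alpha,\alpha),(\alpha,1),(0,1)$. $Y_H$: $(2\alpha,0),(1,0),(1,\alpha),(\alpha,\alpha)$. $Y_I$: $(\alpha,\alpha),(1,\alpha),(1-\alpha,1),(\alpha,1)$. $Y_J$: $(1-\alpha,0),(2\alpha,0),(\alpha,\alpha)$. $Z_K$: $(2\alpha,0),(1,0),(\alpha,1),(\alpha,\alpha)$. $Z_L$: $(\alpha,\alpha),(\alpha,1),(0,1),(0,2\alpha)$. $Z_M$: $(\alpha,0),(2\alpha,0),(\alpha,\alpha)$.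 $Z_N$: $(2\alpha,1),(1,2\alpha),(1,1)$. $Z_O$: $(0,0),(\alpha,0),(\alpha,\alpha),(0,2\alpha)$. $Z_P$: $(1,0),(1,2\alpha),(2\alpha,1),(\alpha,1)$. For a quadruple $u=(i,j,k,\ell)$ let $P_u=Y_i\cap Z_j\cap R_{\mathcal{U}}^{(1,0)}(Y_k)\cap R_{\mathcal{U}}^{(0,1)}(Z_\ell)$. The quadruples for which $P_u\ne\varnothing$ are exactly the elements of $\mathcal{U}$, and $\mathcal{P}_{\mathcal{U}}=\{P_u\}_{u\in\mathcal{U}}$. Generic and singular configurations. The paper proves that $\Omega_{\mathcal{U}}$ equals the subshift $\mathcal{X}_{\mathcal{P}_{\mathcal{U}},R_{\mathcal{U}}}$ whose language is the set of patterns $w\in\mathcal{U}^S$ ($S\subset\mathbb{Z}^2$ finite) with $\bigcap_{k\in S}R_{\mathcal{U}}^{-k}(P_{w_k})\ne\varnothing$, and that for $w\in\Omega_{\mathcal{U}}$ the set $\bigcap_{n\ge0}\overline{D_n(w)}$, where $D_n(w)=\bigcap_{|k_1|+|k_2|\le n}R_{\mathcal{U}}^{-k}(P_{w_k})$, is a single point, denoted $f_{\mathcal{U}}(w)\in\mathbb{T}^2$. Let $\Delta_{\mathcal{P}_{\mathcal{U}},R_{\mathcal{U}}}=\bigcup_{n\in\mathbb{Z}^2}R_{\mathcal{U}}^n\big(\bigcup_{u}\partial P_u\big)$. The configuration $w$ is singular if $f_{\mathcal{U}}(w)\in\Delta_{\mathcal{P}_{\mathcal{U}},R_{\mathcal{U}}}$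 and generic otherwise. Occurrences. A pattern is a map $p:S\to\mathcal{U}$ with $S\subset\mathbb{Z}^2$ finite; here $p$ is a pattern occurring in $w$, and its set of occurrences is $Q=\{n\in\mathbb{Z}^2: w_{n+k}=p_k\text{ for all }k\in S\}$. Model sets. A cut and project scheme (CPS) is a triple $(\mathbb{R}^d,H,\mathcal{L})$ with a (compactly generated) locally compact Abelian group $H$, a lattice $\mathcal{L}$ in $\mathbb{R}^d\times H$ and the natural projections $\pi:\mathbb{R}^d\times H\to\mathbb{R}^d$, $\pi_{\rm int}:\mathbb{R}^d\times H\to H$, such that $\pi|_{\mathcal{L}}$ is injective and $\pi_{\rm int}(\mathcal{L})$ is dense in $H$. Let $L=\pi(\mathcal{L})$, let $x^\star=\pi_{\rm int}((\pi|_{\mathcal{L}})^{-1}(x))$ for $x\in L$, and $L^\star=\{x^\star:x\in L\}$. For $A\subset H$ let $\curlywedge(A)=\{x\in L: x^\star\in A\}$. If $A$ (the window) is relatively compact with nonempty interior, $\curlywedge(A)$, or any translate $t+\curlywedge(A)$ with $t\in\mathbb{R}^d$, is called a model set. It is regular when $\mu_H(\partial A)=0$ with $\mu_H$ the Haar measure of $H$; it is generic if $L^\star\cap\partial A=\varnothing$ and singular if $L^\star\cap\partial A\ne\varnothing$. *)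

(* Defs.v *)
From HB Require Import structures.
From mathcomp Require Import all_boot all_order all_algebra.
From mathcomp Require Import all_classical all_reals all_analysis.
Import Order.TTheory GRing.Theory Num.Theory numFieldNormedType.Exports.

Set Implicit Arguments.
Unset Strict Implicit.
Unset Printing Implicit Defensive.

Local Open Scope classical_set_scope.
Local Open Scope ring_scope.

Definition frontier (T : topologicalType) (A : set T) : set T :=
  closure A `\` interior A.

Definition translate (V : zmodType) (t : V) (A : set V) : set V :=
  [set t + x | x in A].

(* Measurable types are pointed: the copy pointed_copy of H has base point 0. *)
Definition pointed_copy (H : topologicalZmodType) : Type := H.
HB.instance Definition _ (H : topologicalZmodType) :=
  Choice.on (pointed_copy H).
HB.instance Definition _ (H : topologicalZmodType) :=
  isPointed.Build (pointed_copy H) (0 : H).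

Definition borel (H : topologicalZmodType) :=
  g_sigma_algebraType (@open H : set (set (pointed_copy H))).

Definition haar_measure (R : realType) (H : topologicalZmodType)
    (mu : {measure set (borel H) -> \bar R}) : Prop :=
  [/\ (0 < mu setT)%E,
      forall (h : H) (B : set (borel H)),
        measurable B -> mu (translate h B) = mu B,
      forall K : set H, compact K -> (mu K < +oo)%E,
      forall B : set (borel H), measurable B ->
        mu B = ereal_inf [set mu U | U in [set U : set H | open U /\ B `<=` U]] &
      forall U : set H, open U ->
        mu U = ereal_sup [set mu K | K in [set K : set H | compact K /\ K `<=` U]]].

Definition subgroup (V : zmodType) (G : set V) : Prop :=
  G 0 /\ forall x y, G x -> G y -> G (x - y).

Definition compactly_generated (H : topologicalZmodType) : Prop :=
  exists2 K : set H, compact K &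
    forall G : set H, subgroup G -> K `<=` G -> G = setT.

Definition lattice (R : realType) (d : nat) (H : topologicalZmodType)
    (L : set ('rV[R]_d * H)%type) : Prop :=
  [/\ subgroup L, L `<=` isolated L &
      exists2 K : set ('rV[R]_d * H)%type, compact K &
        forall x, exists2 l, L l & exists2 k, K k & x = l + k].

Record cut_and_project (R : realType) (d : nat) := CutAndProject {
  internal : topologicalZmodType;
  cps_lattice : set ('rV[R]_d * internal)%type;
  internal_hausdorff : hausdorff_space internal;
  internal_locally_compact : locally_compact [set: internal];
  internal_compactly_generated : compactly_generated internal;
  cps_latticeP : lattice cps_lattice;
  cps_injective : {in cps_lattice &, injective fst};
  cps_dense : dense (snd @` cps_lattice)
}.

Arguments cps_lattice {R d} c _.

Section model_sets.
Context (R : realType) (d : nat) (C : cut_and_project R d).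

Definition projected_lattice : set 'rV[R]_d := fst @` cps_lattice C.

Definition star (x : 'rV[R]_d) : internal C :=
  (xget 0 [set z | cps_lattice C z /\ z.1 = x]).2.

Definition curlywedge (A : set (internal C)) : set 'rV[R]_d :=
  [set x | projected_lattice x /\ A (star x)].

Definition window (A : set (internal C)) : Prop :=
  precompact A /\ interior A !=set0.

(* Haar measure is unique up to a positive factor, so its choice is
   irrelevant here. *)
Definition regular_window (A : set (internal C)) : Prop :=
  exists2 mu : {measure set (borel (internal C)) -> \bar R},
    haar_measure mu & mu (frontier A) = 0%E.

Definition generic_window (A : set (internal C)) : Prop :=
  (star @` projected_lattice) `&` frontier A = set0.

Definition singular_window (A : set (internal C)) : Prop :=
  (star @` projected_lattice) `&` frontier A !=set0.

End model_sets.

(* A tile is (right, top, left, bottom); C colours the vertical edges and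
   D the horizontal ones. *)
Definition wang_tile (C D : Type) : Type := (C * D * C * D)%type.

Section wang.
Context (C D : Type).
Definition right_of (u : wang_tile C D) : C := u.1.1.1.
Definition top_of (u : wang_tile C D) : D := u.1.1.2.
Definition left_of (u : wang_tile C D) : C := u.1.2.
Definition bottom_of (u : wang_tile C D) : D := u.2.

Definition wang_shift (T : set (wang_tile C D)) :
    set (int * int -> wang_tile C D) :=
  [set x | [/\ forall n, T (x n),
               forall n, right_of (x n) = left_of (x (n + (1, 0))) &
               forall n, top_of (x n) = bottom_of (x (n + (0, 1)))]].

Definition occurrences (w : int * int -> wang_tile C D)
    (S : set (int * int)) (p : int * int -> wang_tile C D) : set (int * int) :=
  [set n | forall k, S k -> w (n + k) = p k].
End wang.

Variant side_color := cA | cB | cC | cD | cE | cF | cG | cH | cI | cJ.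
Variant top_color := cK | cL | cM | cN | cO | cP.

Scheme Boolean Equality for side_color.
Scheme Boolean Equality for top_color.

Fact side_color_eqP : Equality.axiom side_color_beq.
Proof. by do 2!case; constructor. Qed.
HB.instance Definition _ := hasDecEq.Build side_color side_color_eqP.

Fact top_color_eqP : Equality.axiom top_color_beq.
Proof. by do 2!case; constructor. Qed.
HB.instance Definition _ := hasDecEq.Build top_color top_color_eqP.

Definition tile := wang_tile side_color top_color.

Definition tiles_U : seq tile :=
  [:: (cF, cO, cJ, cO); (cF, cO, cH, cL); (cJ, cM, cF, cP); (cD, cM, cF, cK);
      (cH, cP, cJ, cP); (cH, cP, cH, cN); (cH, cK, cF, cP); (cH, cK, cD, cP);
      (cB, cO, cI, cO); (cG, cL, cE, cO); (cG, cL, cC, cL); (cA, cL, cI, cO);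
      (cE, cP, cG, cP); (cE, cP, cI, cP); (cI, cP, cG, cK); (cI, cP, cI, cK);
      (cI, cK, cB, cM); (cI, cK, cA, cK); (cC, cN, cI, cP)].

Definition Omega_U : set (int * int -> tile) := wang_shift [set` tiles_U].

Definition Z2 (R : realType) : {pred (R * R)%type} :=
  [pred x | (x.1 \is a Num.int) && (x.2 \is a Num.int)].
Arguments Z2 : clear implicits.

Fact Z2_zmod_closed (R : realType) : zmod_closed (Z2 R).
Proof.
split=> [|x y /andP[x1 x2] /andP[y1 y2]]; first by rewrite inE /= !rpred0.
by rewrite inE /= !rpredB.
Qed.
HB.instance Definition _ (R : realType) :=
  GRing.isZmodClosed.Build (R * R)%type (Z2 R) (Z2_zmod_closed R).

Definition torus (R : realType) : Type := @Quotient.quot (R * R)%type (Z2 R).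
HB.instance Definition _ (R : realType) := GRing.Zmodule.on (torus R).
HB.instance Definition _ (R : realType) := Quotient.on (torus R).

Section torus_topology.
Context (R : realType).

(* This is the topology of quotient_topology; that type carries an equality
   structure that differs from the one of the group quotient, so the topology
   is put directly on the latter. *)
Definition torus_open (A : set (torus R)) : Prop :=
  open (\pi_(torus R)%qT @^-1` A).

Fact torus_openT : torus_open setT.
Proof. by rewrite /torus_open preimage_setT; exact: openT. Qed.

Fact torus_openI A B : torus_open A -> torus_open B -> torus_open (A `&` B).
Proof. exact: openI. Qed.

Fact torus_open_bigU (I : Type) (F : I -> set (torus R)) :
  (forall i, torus_open (F i)) -> torus_open (\bigcup_i F i).
Proof. by move=> oF; apply: bigcup_open => i _; exact: oF. Qed.

HB.instance Definition _ := isOpenTopological.Build (torus R)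
  torus_openT torus_openI torus_open_bigU.
End torus_topology.

Section partition.
Context (R : realType).

Definition phi : R := (1 + Num.sqrt 5) / 2.
Definition alpha : R := phi ^- 2.

Local Notation a := alpha.

Definition R_U (n : int * int) (x : torus R) : torus R :=
  x + \pi_(torus R)%qT (a *~ n.1, a *~ n.2).

(* All the polygons below are convex, so the polygon with vertices s is the
   convex hull of s. *)
Definition polygon (s : seq (R * R)) : set (R * R) :=
  smallest (@convex_set R (R^o * R^o)%type) [set` s].

Definition side_polygon (c : side_color) : seq (R * R) :=
  match c with
  | cA => [:: (0, 2 * a); (a, a); (0, 1)]
  | cB => [:: (0, a); (a, a); (0, 2 * a)]
  | cC => [:: (2 * a, 1); (1, 2 * a); (1, 1)]
  | cD => [:: (a, 0); (1 - a, 0); (a, a)]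
  | cE => [:: (1, a); (1, 2 * a); (2 * a, 1); (1 - a, 1)]
  | cF => [:: (0, 0); (a, 0); (a, a); (0, a)]
  | cG => [:: (a, a); (a, 1); (0, 1)]
  | cH => [:: (2 * a, 0); (1, 0); (1, a); (a, a)]
  | cI => [:: (a, a); (1, a); (1 - a, 1); (a, 1)]
  | cJ => [:: (1 - a, 0); (2 * a, 0); (a, a)]
  end.

Definition top_polygon (c : top_color) : seq (R * R) :=
  match c with
  | cK => [:: (2 * a, 0); (1, 0); (a, 1); (a, a)]
  | cL => [:: (a, a); (a, 1); (0, 1); (0, 2 * a)]
  | cM => [:: (a, 0); (2 * a, 0); (a, a)]
  | cN => [:: (2 * a, 1); (1, 2 * a); (1, 1)]
  | cO => [:: (0, 0); (a, 0); (a, a); (0, 2 * a)]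
  | cP => [:: (1, 0); (1, 2 * a); (2 * a, 1); (a, 1)]
  end.

Definition Y_U (c : side_color) : set (torus R) :=
  \pi_(torus R)%qT @` interior (polygon (side_polygon c)).
Definition Z_U (c : top_color) : set (torus R) :=
  \pi_(torus R)%qT @` interior (polygon (top_polygon c)).

Definition P_U (u : tile) : set (torus R) :=
  Y_U (right_of u) `&` Z_U (top_of u) `&` R_U (1, 0) @` Y_U (left_of u)
    `&` R_U (0, 1) @` Z_U (bottom_of u).

Definition D_U (w : int * int -> tile) (n : nat) : set (torus R) :=
  \bigcap_(k in [set k : int * int | (`|k.1| + `|k.2| <= n)%N])
    R_U (- k) @` P_U (w k).

(* For w in Omega_U the intersection below is a single point. *)
Definition f_U (w : int * int -> tile) : torus R :=
  xget 0 (\bigcap_n closure (D_U w n)).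

Definition Delta : set (torus R) :=
  \bigcup_n (R_U n @` \bigcup_(u in [set` tiles_U]) frontier (P_U u)).

Definition singular_config (w : int * int -> tile) : Prop := Delta (f_U w).
Definition generic_config (w : int * int -> tile) : Prop := ~ singular_config w.

Definition embed (n : int * int) : 'rV[R]_2 :=
  \row_(i < 2) (if i == ord0 then n.1 else n.2)%:~R.

End partition.
Arguments singular_config : clear implicits.
Arguments generic_config : clear implicits.

(* Main.v *)
From HB Require Import structures.
Require Import Defs.
From mathcomp Require Import all_boot all_order all_algebra.
From mathcomp Require Import all_classical all_reals all_analysis.
From mathcomp Require Import measurable_realfun.
From mathcomp Require Import zify ring lra.
Import Order.TTheory GRing.Theory Num.Theory numFieldNormedType.Exports.

Local Open Scope classical_set_scope.
Local Open Scope ring_scope.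

(** The torus [T^2] with the translation by [alpha] in both directions gives
    the scheme: its internal space is [T^2] and its lattice is the graph of
    [n |-> n alpha mod 1].  Once every tiling [w] of the Wang shift is known to
    code the orbit of a point [x] of the torus, the theorem is soft.  The
    intersection over [k] in [S] of the atoms [P_(p k)], each moved by
    [- k alpha], is open, and the pattern occurs in [w] at [n] if
    [x + n alpha] is in this intersection and only if it is in its closure.
    Seen from [x], the window is this open set together with the points
    [n alpha] at which the pattern does occur.  Its frontier lies in finitely
    many segments, hence is null, and it meets the orbit only if [x] is on
    [Delta].

    The substance is the coding, [Omega_realized]: every rectangular pattern
    of a tiling is read off along the orbit of some point.  The proof is a
    renormalization.  The colours show that each column of a tiling is
    narrow or wide and each row low or tall; narrow columns are isolated, and
    so are low rows.  Grouping each narrow column with the wide one before it,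
    and each low row with the tall one below it, cuts a tiling into blocks of
    at most two by two tiles.  An enumeration of the 4 x 3 patches shows that
    only 19 blocks occur and that their sides match exactly as the tiles do,
    so that the blocks form a tiling by the same tiles
    ([Omega_desubstitution]).  On the torus, the contraction by [- 1 / phi]
    conjugates the translation by [alpha] to the map of first return to the
    square of side [1 - alpha], and it maps the cell of a tile into the cells
    of the tiles of its block ([cell_omega]).  Hence a pattern is realized as
    soon as the pattern of the blocks that cover it is.  Desubstituting
    repeatedly leads to patterns of at most two by two tiles; there are 50 of
    them, by an enumeration of the 5 x 4 patches, and each is seen along the
    orbit of the origin ([seed_realized]).

    All edges of the partition have one of four directions.  A convex polygon
    with such edges is described by bounds on four linear forms, with values
    in [Z[alpha]], so that the inclusions above amount to comparisons of
    integers and are proved by computation.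

    A compactness argument turns realized patterns into a point in the
    closure of all the sets [D_n w] ([f_UP]).  Regularity of windows requires
    a Haar measure: it is the image of Lebesgue measure on the unit square,
    invariant by cut and paste ([band_shift]), and regular because open sets of
    the torus are countable unions of closed ones ([borel_approximable]).

    The frontier of this window depends on the pattern and may miss the orbit
    even if [x] is on [Delta]; if [S] is empty, so is the frontier.  But the
    model set only determines which points of the orbit are in the window,
    and for singular tilings other points are removed from it so that its
    frontier meets the orbit ([adjusted_window]). *)

(** * Finite patches of a tiling *)

(** The shorter chains are bound by [let] so that they are computed once, and
    not once for each head. *)
Fixpoint chains {A : Type} (e : rel A) (s : seq A) (n : nat) : seq (seq A) :=
  if n is n'.+1 then
    if n' is 0%N then [seq [:: x] | x <- s] else
    let t := chains e s n' in
    [seq x :: c | x <- s, c <- [seq c <- t |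
       if c is y :: _ then e x y else false]]
  else [:: [::]].

Lemma mem_chains (A : eqType) (e : rel A) (s : seq A) (c : seq A) :
  all (mem s) c -> sorted e c -> c \in chains e s (size c).
Proof.
elim: c => [|x [|y c] IH] //=.
  by rewrite andbT => xs _; apply: map_f.
move=> /and3P[xs ys cs] /andP[exy pyc].
apply: (allpairs_f_dep cons xs).
by rewrite mem_filter exy; apply: IH; rewrite //= ys.
Qed.

Definition hmatch (u v : tile) := right_of u == left_of v.
Definition vmatch (u v : tile) := top_of u == bottom_of v.
(** A patch is the list of its rows, from bottom to top. *)
Definition patches m n : seq (seq (seq tile)) :=
  chains (all2 vmatch) (chains hmatch tiles_U m) n.

Definition patch_at (w : int * int -> tile) (o : int * int) m n :
  seq (seq tile) :=
  mkseq (fun j => mkseq (fun i => w (o.1 + i%:Z, o.2 + j%:Z)) m) n.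

Lemma sorted_mkseq (A : Type) (e : rel A) (f : nat -> A) n :
  (forall i, e (f i) (f i.+1)) -> sorted e (mkseq f n).
Proof.
move=> fe; case: n => // n; rewrite /mkseq /=.
by elim: n 0%N => //= n IH k; rewrite fe /=; exact: IH.
Qed.

Lemma addpairE (a b c d : int) : (a, b) + (c, d) = (a + c, b + d).
Proof. by []. Qed.

Lemma Omega_patch w o m n : Omega_U w -> patch_at w o m n \in patches m n.
Proof.
move=> [wT wh wv].
rewrite -[n in patches m n](size_mkseq
  (fun j => mkseq (fun i => w (o.1 + i%:Z, o.2 + j%:Z)) m) n).
apply: mem_chains.
  apply/allP => r /mapP[j _ ->].
  set r' := mkseq _ _.
  rewrite -[X in chains _ _ X](size_mkseq (fun i => w (o.1 + i%:Z, o.2 + j%:Z)) m).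
  apply: mem_chains; first by apply/allP => t /mapP[i _ ->]; exact: wT.
  apply: sorted_mkseq => i; rewrite /hmatch wh.
  by rewrite addpairE addr0 -addrA -PoszD addn1 eqxx.
apply: sorted_mkseq => j; rewrite /mkseq.
elim: (iota 0 m) => //= i s ->; rewrite andbT /vmatch wv.
by rewrite addpairE addr0 -addrA -PoszD addn1 eqxx.
Qed.

Definition u0 : tile := (cF, cO, cJ, cO).
Definition entry (p : seq (seq tile)) i j := nth u0 (nth [::] p j) i.

Lemma entry_patch w o m n i j : (i < m)%N -> (j < n)%N ->
  entry (patch_at w o m n) i j = w (o.1 + i%:Z, o.2 + j%:Z).
Proof. by move=> im jn; rewrite /entry !nth_mkseq. Qed.

(** * The substitution and its blocks *)

(** In a tiling that codes an orbit, the colours O and L mark the abscissas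
    below [alpha], and D, F, H and J the ordinates below [alpha]; see
    [cell_interval]. *)
Definition wide (u : tile) := top_of u \notin [:: cO; cL].
Definition tall (u : tile) := right_of u \notin [:: cD; cF; cH; cJ].
Definition width (u : tile) : nat := (wide u).+1.
Definition height (u : tile) : nat := (tall u).+1.

(** The blocks of the 19 tiles, in the order of [tiles_U]: lists of rows, from
    bottom to top, of indices in [tiles_U]. *)
Definition omega_table : seq (seq (seq nat)) :=
  [:: [:: [:: 17]]; [:: [:: 16]]; [:: [:: 15; 11]]; [:: [:: 13; 9]];
      [:: [:: 17; 8]]; [:: [:: 16; 8]]; [:: [:: 15; 8]]; [:: [:: 14; 8]];
      [:: [:: 14]; [:: 6]]; [:: [:: 17]; [:: 3]]; [:: [:: 16]; [:: 3]];
      [:: [:: 14]; [:: 2]];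
      [:: [:: 15; 11]; [:: 7; 1]]; [:: [:: 14; 11]; [:: 6; 1]];
      [:: [:: 13; 9]; [:: 7; 1]]; [:: [:: 12; 9]; [:: 6; 1]];
      [:: [:: 18; 10]; [:: 5; 1]]; [:: [:: 13; 9]; [:: 4; 1]];
      [:: [:: 14; 8]; [:: 2; 0]]]%N.

Definition omega (u : tile) (i j : nat) : tile :=
  nth u0 tiles_U
    (nth 0%N (nth [::] (nth [::] omega_table (index u tiles_U)) j) i).

Arguments omega : simpl never.

(** The first two conditions tell where the block ends: it extends to the right
    (up) exactly when the next column (row) is narrow (low). *)
Definition is_block (u : tile) (t : nat -> nat -> tile) : bool :=
  [&& wide u == ~~ wide (t 1%N 0%N), tall u == ~~ tall (t 0%N 1%N) &
   all (fun j => all (fun i => t i j == omega u i j) (iota 0 (width u)))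
     (iota 0 (height u))].

Definition desubstitutable (t : nat -> nat -> tile) : bool :=
  wide (t 0%N 0%N) && tall (t 0%N 0%N) ==> has (is_block^~ t) tiles_U.

(** The columns on both sides and the row below are there to exclude blocks
    that respect the matching rules but extend to no tiling. *)
Lemma patches_block :
  all (fun p => desubstitutable (fun i j => entry p i.+1 j.+1)) (patches 4 3).
Proof. by vm_compute. Qed.

(** The word of colours on a side of a block determines the colour on the same
    side of the tile that it stands for. *)
Lemma hmatch_omega : all (fun u => all (fun v =>
  (tall u == tall v) &&
  all (fun j => hmatch (omega u (wide u) j) (omega v 0 j)) (iota 0 (height u))
   ==> hmatch u v) tiles_U) tiles_U.
Proof. by vm_compute. Qed.

Lemma vmatch_omega : all (fun u => all (fun v =>
  (wide u == wide v) &&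
  all (fun i => vmatch (omega u i (tall u)) (omega v i 0)) (iota 0 (width u))
   ==> vmatch u v) tiles_U) tiles_U.
Proof. by vm_compute. Qed.

(** Thus the type of a tile is shared by its whole column. *)
Lemma wide_bottom : all (fun u => wide u == (bottom_of u \notin [:: cO; cL])) tiles_U.
Proof. by vm_compute. Qed.

Lemma tall_left : all (fun u => tall u == (left_of u \notin [:: cD; cF; cH; cJ])) tiles_U.
Proof. by vm_compute. Qed.

Lemma narrow_isolated : all (fun u => all (fun v =>
  hmatch u v ==> wide u || wide v) tiles_U) tiles_U.
Proof. by vm_compute. Qed.

(** The matching rules allow a low tile above another one; only the
    enumeration of wider patches excludes it. *)
Lemma low_isolated :
  all (fun p => tall (entry p 0 0) || tall (entry p 0 1)) (patches 5 4).
Proof. by vm_compute. Qed.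

Lemma wide_column w i j : Omega_U w -> wide (w (i, j)) = wide (w (i, 0)).
Proof.
move=> [wT _ wv].
have step k : wide (w (i, k + 1)) = wide (w (i, k)).
  have /= := allP wide_bottom _ (wT (i, k + 1)) => /eqP ->.
  by rewrite /wide wv addpairE addr0.
elim/int_rect: j => [|j ih|j ih] //; first by rewrite -addn1 PoszD step.
by rewrite -ih -step; congr (wide (w (i, _))); lia.
Qed.

Lemma tall_row w i j : Omega_U w -> tall (w (i, j)) = tall (w (0, j)).
Proof.
move=> [wT wh _].
have step k : tall (w (k + 1, j)) = tall (w (k, j)).
  have /= := allP tall_left _ (wT (k + 1, j)) => /eqP ->.
  by rewrite /tall wh addpairE addr0.
elim/int_rect: i => [|i ih|i ih] //; first by rewrite -addn1 PoszD step.
by rewrite -ih -step; congr (tall (w (_, j))); lia.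
Qed.

Lemma wide_isolated w i j : Omega_U w -> wide (w (i, j)) || wide (w (i + 1, j)).
Proof.
move=> [wT wh _].
have /allP h := allP narrow_isolated _ (wT (i, j)).
by have /implyP := h _ (wT (i + 1, j)); apply; rewrite /hmatch wh addpairE addr0.
Qed.

Lemma tall_isolated w i j : Omega_U w -> tall (w (i, j)) || tall (w (i, j + 1)).
Proof.
move=> Ow; have := allP low_isolated _ (Omega_patch w (i, j) 5 4 Ow).
by rewrite !entry_patch //= !addr0.
Qed.

Lemma Omega_block w i j : Omega_U w -> wide (w (i, j)) -> tall (w (i, j)) ->
  exists2 u, u \in tiles_U & is_block u (fun k l => w (i + k%:Z, j + l%:Z)).
Proof.
move=> Ow wij tij; have := allP patches_block _ (Omega_patch w (i - 1, j - 1) 4 3 Ow).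
have E k l : (k < 3)%N -> (l < 2)%N ->
    entry (patch_at w (i - 1, j - 1) 4 3) k.+1 l.+1 = w (i + k%:Z, j + l%:Z).
  by move=> k3 l2; rewrite entry_patch //=; congr (w (_, _)); lia.
rewrite /desubstitutable !E// !addr0 wij tij => /hasP[u uT].
move=> /and3P[/eqP uw /eqP ut ub]; exists u => //; apply/and3P.
split; [by rewrite uw E | by rewrite ut E | ].
apply/allP => l lh; apply/allP => k kw; rewrite -E.
- by have /allP := allP ub _ lh; apply.
- by move: kw; rewrite mem_iota /width; case: (wide u) => /=; lia.
- by move: lh; rewrite mem_iota /height; case: (tall u) => /=; lia.
Qed.

(** * Desubstitution *)

Definition next_start (c : int -> bool) (x : int) : int :=
  x + 1 + (~~ c (x + 1) : nat)%:Z.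

(** Blocks begin at the wide columns; a narrow one ends the block that begins
    just before it. *)
Lemma block_starts (c : int -> bool) (o : int) :
  (forall i, c i || c (i + 1)) ->
  exists a : int -> int, [/\ forall k, c (a k),
    forall k, a (k + 1) = next_start c (a k) & a 0 <= o < a 1].
Proof.
move=> iso.
pose prev x := if c (x - 1) then x - 1 else x - 2.
have cnext x : c (next_start c x).
  rewrite /next_start; case: (boolP (c (x + 1))) => [|ncx] /=; first by rewrite addr0.
  by have := iso (x + 1); rewrite (negbTE ncx).
have cprev x : c (prev x).
  rewrite /prev; case: ifPn => // ncx; have := iso (x - 2).
  by rewrite (_ : x - 2 + 1 = x - 1) ?(negbTE ncx) ?orbF //; lia.
have prevK x : c x -> next_start c (prev x) = x.
  move=> cx; rewrite /prev /next_start; case: ifPn => ncx.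
    by rewrite (_ : x - 1 + 1 = x) ?cx /=; lia.
  by rewrite (_ : x - 2 + 1 = x - 1) ?ncx /=; lia.
pose s := if c o then o else o - 1.
have cs : c s.
  rewrite /s; case: ifPn => // nco; have := iso (o - 1).
  by rewrite subrK (negbTE nco) orbF.
exists (fun k => match k with Posz n => iter n (next_start c) s
                            | Negz n => iter n.+1 prev s end); split.
- by case=> [[|n]|n] //=.
- case=> [n|[|n]].
  + by rewrite -PoszD addn1.
  + by rewrite /= prevK.
  + rewrite (_ : Negz n.+1 + 1 = Negz n) /=; last by lia.
    by rewrite prevK.
- rewrite /= /s /next_start; case: (boolP (c o)) => co; first by lia.
  by rewrite subrK co /=; lia.
Qed.

(** [N] desubstitutions are enough to reduce the [m] columns starting at [o] to
    at most two.  Three columns reduce at once to two if the middle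
    one is narrow, since it is in the same block as the column before it;
    otherwise one more step may be needed. *)
Definition fits (N : nat) (c : int -> bool) (o : int) (m : nat) : bool :=
  if (m <= 2)%N then true else
  if m == 3%N then ((if c (o + 1)%R then 2 else 1) <= N)%N else (m <= N)%N.

(** Two blocks of width one are never adjacent.  Hence [m >= 4] columns meet
    fewer than [m] blocks, and if three columns meet three blocks then the
    middle one has width one, a case that [fits] counts as one step less. *)
Lemma block_cover (c : int -> bool) (o : int) (a : int -> int) (N m : nat) :
  let c' k := ~~ c (a k + 1) in
  (forall i, c i || c (i + 1)) -> (forall k, c' k || c' (k + 1)) ->
  (forall k, c (a k)) -> (forall k, a (k + 1) = next_start c (a k)) ->
  a 0 <= o < a 1 -> fits N.+1 c o m ->
  exists2 n : nat, fits N c' 0 n &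
    forall i, (i < m)%N -> exists k : nat, exists e : nat,
      [/\ (k < n)%N, (e <= c' k)%N & o + i%:Z = a k + e%:Z].
Proof.
move=> c' iso iso' ca an /andP[a0o oa1] fm.
rewrite -[0]/(0%N%:Z) in a0o; rewrite -[1]/(1%N%:Z) in oa1.
have a1 (k : int) : a (k + 1) = a k + 1 + (c' k : nat)%:Z by rewrite an.
have aS (k : nat) : a k.+1 = a k + 1 + (c' k : nat)%:Z by rewrite -addn1 PoszD a1.
have iS (k : nat) : c' k || c' k.+1 by rewrite -addn1 PoszD iso'.
have cov (n : nat) : forall i : nat, o + i%:Z < a n -> exists k : nat, exists e : nat,
      [/\ (k < n)%N, (e <= c' k)%N & o + i%:Z = a k + e%:Z].
  elim: n => [|n IH] i; first by lia.
  case: (ltP (o + i%:Z) (a n)) => [/IH[k [e [kn ek ->]]]|ain] ain1.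
    by exists k, e; split=> //; lia.
  (* the offset in the block, 0 or 1 *)
    exists n, (absz (o + i%:Z - a n)%R); rewrite aS in ain1.
  by split; [| by case: (c' n) ain1 => /=; lia | lia].
have [n fn omn] : exists2 n : nat, fits N c' 0 n & o + m%:Z <= a n; last first.
  by exists n => // i im; apply: cov; lia.
have [[A1 A2] A3] := (aS 0%N, aS 1%N, aS 2%N).
have [B0 B1] := (iS 0%N, iS 1%N).
have co1 : a 0%N = o -> c (o + 1) = ~~ c' 0%N by move=> <-; rewrite /c' negbK.
move: fm; rewrite /fits; case: leqP => [m2 _|m2].
  by exists 2%N => //; move: A1 A2 B0; case: (c' 0%N); case: (c' 1%N) => //=; lia.
case: eqP => [m3|m3] fm.
  case: (boolP (c' 0%N && ~~ c' 1%N && (a 0%N < o))) => [/andP[/andP[c0 c1] ao]|h].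
    exists 3%N; last first.
      by move: A1 A2 A3 B0 B1; rewrite c0 (negbTE c1) => /=; case: (c' 2%N); lia.
    have co : c (o + 1).
      by rewrite (_ : o + 1 = a 1%N) //; move: A1; rewrite c0 /=; lia.
    by move: fm; rewrite /= add0r (negbTE c1) co.
  exists 2%N => //.
  case: (boolP (a 0%N < o)) => ao.
    rewrite ao andbT in h.
    by move: A1 A2 B0 h; case: (c' 0%N); case: (c' 1%N) => //=; lia.
  have ao' : a 0%N = o by lia.
  have {}co1 := co1 ao'.
  by move: A1 A2 B0 h; case: (c' 0%N); case: (c' 1%N) => //=; lia.
have mE : (4 <= m)%N by lia.
exists m.-1.
  by case: m mE {m2 m3} fm => [|[|[|[|[|m]]]]] //= _; case: (c' _); lia.
clear fm m2 m3; case: m mE => // m; rewrite ltnS /=.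
elim: m => // m IH; rewrite leq_eqVlt => /orP[/eqP <-|m3].
  by move: A1 A2 A3 B0 B1; case: (c' 0%N); case: (c' 1%N); case: (c' 2%N) => //=; lia.
by have := IH m3; rewrite aS; case: (c' m) => /=; lia.
Qed.

Definition col_wide (w : int * int -> tile) (i : int) := wide (w (i, 0)).
Definition row_tall (w : int * int -> tile) (j : int) := tall (w (0, j)).

(** The block of [w' (k, l)] sits in [w] with its lower left tile at
    [(a k, b l)]. *)
Record desubstitution (w w' : int * int -> tile) (a b : int -> int) : Prop := {
  desub_Omega : Omega_U w';
  desub_col k : col_wide w (a k);
  desub_row l : row_tall w (b l);
  desub_colS k : a (k + 1) = next_start (col_wide w) (a k);
  desub_rowS l : b (l + 1) = next_start (row_tall w) (b l);
  desub_wide k : col_wide w' k = ~~ col_wide w (a k + 1);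
  desub_tall l : row_tall w' l = ~~ row_tall w (b l + 1);
  desub_omega k l (i j : nat) :
    (i <= col_wide w' k)%N -> (j <= row_tall w' l)%N ->
    w (a k + i%:Z, b l + j%:Z) = omega (w' (k, l)) i j }.

Lemma Omega_desubstitution w o : Omega_U w ->
  exists w', exists a, exists b, [/\ desubstitution w w' a b,
    a 0 <= o.1 < a 1 & b 0 <= o.2 < b 1].
Proof.
move=> Ow.
have colE i j : wide (w (i, j)) = col_wide w i by rewrite wide_column.
have rowE i j : tall (w (i, j)) = row_tall w j by rewrite tall_row.
have [a [ca aS ao]] : exists a : int -> int, [/\ forall k, col_wide w (a k),
    forall k, a (k + 1) = next_start (col_wide w) (a k) & a 0 <= o.1 < a 1].
  exact: (block_starts _ _ (fun i => wide_isolated w i 0 Ow)).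
have [b [db bS bo]] : exists b : int -> int, [/\ forall k, row_tall w (b k),
    forall k, b (k + 1) = next_start (row_tall w) (b k) & b 0 <= o.2 < b 1].
  exact: (block_starts _ _ (fun j => tall_isolated w 0 j Ow)).
have /choice[w' w'P] (n : int * int) : exists u, u \in tiles_U /\
    is_block u (fun k l => w (a n.1 + k%:Z, b n.2 + l%:Z)).
  have wn : wide (w (a n.1, b n.2)) by rewrite colE.
  have tn : tall (w (a n.1, b n.2)) by rewrite rowE.
  have [u uT ub] := Omega_block w _ _ Ow wn tn.
  by exists u.
have wE n : wide (w' n) = ~~ col_wide w (a n.1 + 1).
  by have [_ /and3P[/eqP -> _ _]] := w'P n; rewrite colE.
have tE n : tall (w' n) = ~~ row_tall w (b n.2 + 1).
  by have [_ /and3P[_ /eqP -> _]] := w'P n; rewrite rowE.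
have oE n (i j : nat) : (i <= wide (w' n))%N -> (j <= tall (w' n))%N ->
    w (a n.1 + i%:Z, b n.2 + j%:Z) = omega (w' n) i j.
  move=> iw jt; have [_ /and3P[_ _ /allP h]] := w'P n.
  have ji : j \in iota 0 (height (w' n)) by rewrite mem_iota add0n ltnS.
  have ii : i \in iota 0 (width (w' n)) by rewrite mem_iota add0n ltnS.
  have /allP h' := h _ ji.
  by apply/eqP; exact: h' _ ii.
have [wT wh wv] := Ow.
have Ow' : Omega_U w'.
  split=> [n|[k l]|[k l]]; first by have [] := w'P n.
    have [uT _] := w'P (k, l); have [vT _] := w'P (k + 1, l).
    rewrite addpairE addr0; have /allP h := allP hmatch_omega _ uT.
    have /implyP h' := h _ vT; apply/eqP; apply: h'.
    rewrite !tE eqxx andTb; apply/allP => j.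
    rewrite mem_iota add0n ltnS => jt.
    rewrite -oE // -oE //=; last by move: jt; rewrite !tE.
    rewrite /hmatch wh addpairE !addr0 aS /next_start wE /=.
    by rewrite addrAC.
  have [uT _] := w'P (k, l); have [vT _] := w'P (k, l + 1).
  rewrite addpairE addr0; have /allP h := allP vmatch_omega _ uT.
  have /implyP h' := h _ vT; apply/eqP; apply: h'.
  rewrite !wE eqxx andTb; apply/allP => i.
  rewrite mem_iota add0n ltnS => iw.
  rewrite -oE // -oE //=; last by move: iw; rewrite !wE.
  rewrite /vmatch wv addpairE !addr0 bS /next_start tE /=.
  by rewrite addrAC.
exists w', a, b; split=> //; split=> //.
- by move=> k; rewrite /col_wide wE.
- by move=> l; rewrite /row_tall tE.
- move=> k l i j ik jl; apply: (oE (k, l)).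
    by rewrite wide_column.
  by rewrite tall_row.
Qed.

(** * Arithmetic of Z[alpha] *)

Section golden.
Context (R : realType).
Local Notation a := (alpha R).

Lemma phi_gt0 : 0 < phi R.
Proof. by rewrite /phi divr_gt0 // addr_gt0 // sqrtr_gt0. Qed.

Lemma phi_sqr : phi R ^+ 2 = phi R + 1.
Proof.
have h : Num.sqrt (5 : R) ^+ 2 = 5 by rewrite sqr_sqrtr.
by rewrite /phi; field: h.
Qed.

Lemma phi_alpha : phi R = 2 - a.
Proof.
have p0 := phi_gt0; have := phi_sqr; rewrite /alpha; set p := phi R in p0 *.
move=> p2; apply: (mulIf (lt0r_neq0 (exprn_gt0 2 p0))).
rewrite mulrBl mulVf ?expf_neq0 ?lt0r_neq0 // p2.
have -> : p * (p + 1) = p ^+ 2 + p by ring.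
by rewrite p2; ring.
Qed.

Lemma alpha_sqr : a * a = 3 * a - 1.
Proof. by have := phi_sqr; rewrite phi_alpha => h; lra. Qed.

Lemma alpha_gt0 : 0 < a.
Proof. by rewrite /alpha invr_gt0 exprn_gt0 // phi_gt0. Qed.

Lemma alpha_lt1 : a < 1.
Proof.
by rewrite /alpha invf_lt1 ?exprn_gt0 ?phi_gt0 // phi_sqr ltrDr phi_gt0.
Qed.

(** Quotients of Fibonacci numbers approach [alpha] from both sides. *)
Lemma alpha_bounds : 21 < 55 * a /\ 89 * a < 34.
Proof.
have [a0 a1 a2] := And3 alpha_gt0 alpha_lt1 alpha_sqr.
by split; rewrite ltNge; apply/negP => h; nra.
Qed.

End golden.

(** The pair [(p, q)] stands for [p + q alpha]. *)
Definition zalpha : Type := (int * int)%type.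
Definition zmul (x y : zalpha) : zalpha :=
  (x.1 * y.1 - x.2 * y.2, x.1 * y.2 + x.2 * y.1 + 3 * (x.2 * y.2)).
(** A test that is only sufficient: [alpha] is replaced with a rational bound,
    which is precise enough for the small coefficients of this file. *)
Definition zpos (x : zalpha) : bool :=
  if 0 <= x.2 then 0 < 55 * x.1 + 21 * x.2 else 0 < 89 * x.1 + 34 * x.2.
Definition zlt (x y : zalpha) : bool := zpos (y - x).
Definition zle (x y : zalpha) : bool := (x == y) || zlt x y.

Section eval.
Context (R : realType).
Local Notation a := (alpha R).

Definition ev (x : zalpha) : R := x.1%:~R + x.2%:~R * a.
Definition ev2 (v : zalpha * zalpha) : R * R := (ev v.1, ev v.2).

Lemma evD x y : ev (x + y) = ev x + ev y.
Proof. by rewrite /ev !intrD; ring. Qed.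
Lemma evN x : ev (- x) = - ev x.
Proof. by rewrite /ev !intrN; ring. Qed.
Lemma evB x y : ev (x - y) = ev x - ev y.
Proof. by rewrite evD evN. Qed.
Lemma evM x y : ev (zmul x y) = ev x * ev y.
Proof.
have h := alpha_sqr R.
by rewrite /ev /= !(intrD, intrM, intrN); ring: h.
Qed.
Lemma ev_int (n : int) : ev (n, 0) = n%:~R.
Proof. by rewrite /ev /= mul0r addr0. Qed.
Lemma ev_alpha (n : int) : ev (0, n) = n%:~R * a.
Proof. by rewrite /ev /= add0r. Qed.

Lemma zpos_gt0 x : zpos x -> 0 < ev x.
Proof.
have [lo hi] := alpha_bounds R; have a0 := alpha_gt0 R.
rewrite /zpos /ev; case: x => p q /=; case: ifPn => q0 h.
  have {}h : 0 < 55 * p%:~R + 21 * q%:~R :> R.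
    by have := h; rewrite -(ltr0z R) intrD !intrM.
  have {}q0 : 0 <= q%:~R :> R by rewrite ler0z.
  by nra.
have {}h : 0 < 89 * p%:~R + 34 * q%:~R :> R.
  by have := h; rewrite -(ltr0z R) intrD !intrM.
have {}q0 : q%:~R < 0 :> R by rewrite ltrz0 ltNge.
by nra.
Qed.

Lemma zlt_ev x y : zlt x y -> ev x < ev y.
Proof. by move/zpos_gt0; rewrite evB subr_gt0. Qed.
Lemma zle_ev x y : zle x y -> ev x <= ev y.
Proof. by case/orP => [/eqP->|/zlt_ev/ltW]. Qed.

End eval.

(** * Polygons with edges in four directions *)

(** Every edge of the partition is parallel to a line on which [x], [y], [x + y]
    or [phi x + y] is constant, where [phi = 2 - alpha].  Bounds on these four
    forms describe all the polygons of the partition. *)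
Definition zform (d : nat) (v : zalpha * zalpha) : zalpha :=
  match d with
  | 0%N => v.1 | 1%N => v.2 | 2%N => v.1 + v.2 | _ => zmul (2, -1) v.1 + v.2
  end.
Definition box : Type := seq (zalpha * zalpha).
Definition lo (b : box) (d : nat) : zalpha := (nth (0, 0) b d).1.
Definition hi (b : box) (d : nat) : zalpha := (nth (0, 0) b d).2.

Definition subbox (b b' : box) : bool :=
  all (fun d => zle (lo b' d) (lo b d) && zle (hi b d) (hi b' d)) (iota 0 4).
Definition disjoint_box (b b' : box) : bool :=
  has (fun d => zle (hi b d) (lo b' d) || zle (hi b' d) (lo b d)) (iota 0 4).
Definition move_box (v : zalpha * zalpha) (b : box) : box :=
  mkseq (fun d => (lo b d + zform d v, hi b d + zform d v)) 4.
(** The image under [z |-> - (1 - alpha) z]. *)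
Definition flip_box (b : box) : box :=
  mkseq (fun d => (- zmul (1, -1) (hi b d), - zmul (1, -1) (lo b d))) 4.
Definition in_box (b : box) (v : zalpha * zalpha) : bool :=
  all (fun d => zlt (lo b d) (zform d v) && zlt (zform d v) (hi b d)) (iota 0 4).

Arguments in_box : simpl never.
Arguments subbox : simpl never.
Arguments move_box : simpl never.
Arguments flip_box : simpl never.

Section boxes.
Context (R : realType).
Local Notation a := (alpha R).

Definition form (d : nat) (z : R * R) : R :=
  match d with
  | 0%N => z.1 | 1%N => z.2 | 2%N => z.1 + z.2 | _ => phi R * z.1 + z.2
  end.

Lemma formD d x y : form d (x + y) = form d x + form d y.
Proof. by case: d => [|[|[|d]]] //=; ring. Qed.
Lemma formN d x : form d (- x) = - form d x.
Proof. by case: d => [|[|[|d]]] //=; ring. Qed.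
Lemma formZ d c x : form d (c * x.1, c * x.2) = c * form d x.
Proof. by case: d => [|[|[|d]]] //=; ring. Qed.
Lemma form_ev d v : form d (ev2 R v) = ev R (zform d v).
Proof.
by case: d => [|[|[|d]]] //=; rewrite evD // evM phi_alpha /ev /=; congr (_ * _ + _); ring.
Qed.

Definition open_box (b : box) : set (R * R) :=
  [set z | forall d, (d < 4)%N -> ev R (lo b d) < form d z < ev R (hi b d)].
Definition closed_box (b : box) : set (R * R) :=
  [set z | forall d, (d < 4)%N -> ev R (lo b d) <= form d z <= ev R (hi b d)].

Lemma subboxP b b' : subbox b b' -> open_box b `<=` open_box b'.
Proof.
move=> /allP s z zb d d4; have /andP[l h] := zb d d4.
have /andP[/(zle_ev R) l' /(zle_ev R) h'] : zle (lo b' d) (lo b d) && zle (hi b d) (hi b' d).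
  by apply: s; rewrite mem_iota.
by rewrite (le_lt_trans l') //= (lt_le_trans h).
Qed.

Lemma disjoint_boxP b b' : disjoint_box b b' -> open_box b `&` open_box b' = set0.
Proof.
move=> /hasP[d]; rewrite mem_iota add0n /= => d4 s.
apply/seteqP; split=> // z [/(_ d d4)/andP[l h] /(_ d d4)/andP[l' h']].
by case/orP: s => /(zle_ev R); lra.
Qed.

Lemma move_boxP v b z : open_box b z -> open_box (move_box v b) (z + ev2 R v).
Proof.
move=> zb d d4; have /andP[l h] := zb d d4.
by rewrite /lo /hi nth_mkseq //= !evD formD form_ev !ltrD2r l.
Qed.

Lemma flip_boxP b (z : R * R) : open_box b z ->
  open_box (flip_box b) (- ((1 - a) * z.1, (1 - a) * z.2)).
Proof.
move=> zb d d4; have /andP[l h] := zb d d4.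
have a1 : 0 < 1 - a by rewrite subr_gt0 alpha_lt1.
have e1 : ev R (1, -1) = 1 - a by rewrite /ev /=; ring.
by rewrite /lo /hi nth_mkseq //= !evN !evM e1 formN formZ !ltrN2 !ltr_pM2l // h.
Qed.

Lemma in_boxP b v : in_box b v -> open_box b (ev2 R v).
Proof.
move=> /allP s d d4; rewrite form_ev.
have /andP[l h] : zlt (lo b d) (zform d v) && zlt (zform d v) (hi b d).
  by apply: s; rewrite mem_iota.
by rewrite !zlt_ev.
Qed.

End boxes.

(** * The cells of the partition and their renormalization *)

(** Tight bounds of the lifts of the atoms to the unit square, in the order of
    [tiles_U]. *)
Definition cells : seq box :=
  [:: [:: ((0, 0), (-1, 3)); ((0, 0), (-1, 3)); ((0, 0), (-1, 3)); ((0, 0), (1, -2))];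
      [:: ((0, 0), (0, 1)); ((0, 0), (0, 1)); ((-1, 3), (0, 2)); ((-1, 3), (1, 0))];
      [:: ((0, 1), (0, 2)); ((0, 0), (0, 1)); ((1, -1), (0, 2)); ((1, 0), (2, -2))];
      [:: ((0, 1), (1, -1)); ((0, 0), (0, 1)); ((0, 1), (0, 2)); ((1, -1), (1, 0))];
      [:: ((0, 2), (1, 0)); ((0, 0), (0, 1)); ((1, 0), (0, 3)); ((2, -1), (1, 2))];
      [:: ((0, 2), (1, 0)); ((-1, 3), (0, 1)); ((0, 3), (1, 1)); ((2, -1), (2, 0))];
      [:: ((0, 1), (0, 2)); ((0, 0), (0, 1)); ((0, 2), (0, 3)); ((1, 0), (2, -1))];
      [:: ((0, 2), (1, 0)); ((0, 0), (0, 1)); ((0, 2), (0, 3)); ((2, -2), (2, -1))];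
      [:: ((0, 0), (0, 1)); ((0, 1), (0, 2)); ((0, 1), (0, 2)); ((0, 1), (1, 0))];
      [:: ((0, 0), (0, 1)); ((0, 1), (1, 0)); ((0, 2), (0, 3)); ((1, 0), (1, 1))];
      [:: ((-1, 3), (0, 1)); ((0, 2), (1, 0)); ((0, 3), (1, 1)); ((2, -2), (2, -1))];
      [:: ((0, 0), (0, 1)); ((0, 1), (1, 0)); ((0, 2), (1, 0)); ((0, 2), (1, 0))];
      [:: ((1, -1), (0, 2)); ((0, 2), (1, 0)); ((0, 4), (1, 2)); ((2, 0), (3, -2))];
      [:: ((0, 2), (1, 0)); ((0, 1), (1, 0)); ((1, 1), (1, 2)); ((2, 0), (2, 1))];
      [:: ((0, 1), (0, 2)); ((0, 1), (1, 0)); ((0, 3), (2, -1)); ((2, -1), (2, 0))];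
      [:: ((0, 2), (1, 0)); ((0, 1), (0, 2)); ((0, 3), (0, 4)); ((2, -1), (2, 0))];
      [:: ((0, 1), (0, 2)); ((0, 1), (0, 2)); ((0, 2), (0, 3)); ((1, 0), (2, -1))];
      [:: ((0, 1), (0, 2)); ((0, 1), (1, 0)); ((0, 3), (1, 1)); ((1, 1), (2, -1))];
      [:: ((0, 2), (1, 0)); ((0, 2), (1, 0)); ((1, 2), (2, 0)); ((3, -2), (3, -1))]].
Definition cell (u : tile) : box := nth [::] cells (index u tiles_U).

Arguments cell : simpl never.

Definition side_vertices (c : side_color) : seq (zalpha * zalpha) :=
  let o : zalpha := (0, 0) in let i : zalpha := (1, 0) in
  let a : zalpha := (0, 1) in let aa : zalpha := (0, 2) in
  let b : zalpha := (1, -1) in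
  match c with
  | cA => [:: (o, aa); (a, a); (o, i)]
  | cB => [:: (o, a); (a, a); (o, aa)]
  | cC => [:: (aa, i); (i, aa); (i, i)]
  | cD => [:: (a, o); (b, o); (a, a)]
  | cE => [:: (i, a); (i, aa); (aa, i); (b, i)]
  | cF => [:: (o, o); (a, o); (a, a); (o, a)]
  | cG => [:: (a, a); (a, i); (o, i)]
  | cH => [:: (aa, o); (i, o); (i, a); (a, a)]
  | cI => [:: (a, a); (i, a); (b, i); (a, i)]
  | cJ => [:: (b, o); (aa, o); (a, a)]
  end.

Definition top_vertices (c : top_color) : seq (zalpha * zalpha) :=
  let o : zalpha := (0, 0) in let i : zalpha := (1, 0) in
  let a : zalpha := (0, 1) in let aa : zalpha := (0, 2) in
  match c with
  | cK => [:: (aa, o); (i, o); (a, i); (a, a)]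
  | cL => [:: (a, a); (a, i); (o, i); (o, aa)]
  | cM => [:: (a, o); (aa, o); (a, a)]
  | cN => [:: (aa, i); (i, aa); (i, i)]
  | cO => [:: (o, o); (a, o); (a, a); (o, aa)]
  | cP => [:: (i, o); (i, aa); (aa, i); (a, i)]
  end.

Lemma side_verticesE (R : realType) c :
  side_polygon R c = map (ev2 R) (side_vertices c).
Proof.
by case: c; rewrite /= /ev2 /ev /=; do ?[congr (_ :: _)]; congr pair; ring.
Qed.

Lemma top_verticesE (R : realType) c :
  top_polygon R c = map (ev2 R) (top_vertices c).
Proof.
by case: c; rewrite /= /ev2 /ev /=; do ?[congr (_ :: _)]; congr pair; ring.
Qed.

Definition zmin (x y : zalpha) := if zle x y then x else y.
Definition zmax (x y : zalpha) := if zle x y then y else x.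
Definition hull_box (vs : seq (zalpha * zalpha)) : box :=
  mkseq (fun d => let s := map (zform d) vs in
    (foldr zmin (head (0, 0) s) s, foldr zmax (head (0, 0) s) s)) 4.

Definition all_sides : seq side_color := [:: cA; cB; cC; cD; cE; cF; cG; cH; cI; cJ].
Definition all_tops : seq top_color := [:: cK; cL; cM; cN; cO; cP].
Definition all_polygons := map side_vertices all_sides ++ map top_vertices all_tops.

(** The lift of the translation by [- alpha] that keeps [(alpha, 1)], or else
    [(0, alpha)], within the unit interval. *)
Definition back_shift (p : bool) : zalpha := if p then (0, -1) else (1, -1).

Lemma cell_sub : all (fun u =>
  [&& subbox (cell u) (hull_box (side_vertices (right_of u))),
      subbox (cell u) (hull_box (top_vertices (top_of u))),
      subbox (move_box (back_shift (wide u), (0, 0)) (cell u))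
        (hull_box (side_vertices (left_of u))) &
      subbox (move_box ((0, 0), back_shift (tall u)) (cell u))
        (hull_box (top_vertices (bottom_of u)))]) tiles_U.
Proof. by vm_compute. Qed.

Definition in_interval (p : bool) (b : zalpha * zalpha) : bool :=
  if p then zle (0, 1) b.1 && zle b.2 (1, 0)
  else zle (0, 0) b.1 && zle b.2 (0, 1).

Lemma cell_interval : all (fun u =>
  in_interval (wide u) (lo (cell u) 0, hi (cell u) 0) &&
  in_interval (tall u) (lo (cell u) 1, hi (cell u) 1)) tiles_U.
Proof. by vm_compute. Qed.

(** The contraction by [- (1 - alpha) = - 1 / phi] is followed by a translation
    such that the images of the wide range [(alpha, 1)] and of the narrow
    range [(0, alpha)] are [(1 - alpha, 1)] and [(alpha, 1 - alpha)], side by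
    side; then comes, for [i = 1], a step of the translation by [alpha],
    which wraps around the circle. *)
Definition block_shift (p : bool) (i : nat) : zalpha :=
  (if p then (2, -2) else (1, -1)) + (- i%:Z, i%:Z).

(** This is the renormalization: the contraction maps the cell of a tile into
    the cell of the first tile of its block, and the translation by [alpha]
    then runs through the cells of the other tiles of the block. *)
Lemma cell_omega : all (fun u => all (fun i => all (fun j =>
  subbox (move_box (block_shift (wide u) i, block_shift (tall u) j)
           (flip_box (cell u))) (cell (omega u i j)))
  (iota 0 (height u))) (iota 0 (width u))) tiles_U.
Proof. by vm_compute. Qed.

(** The point [k alpha mod 1], for [k] small enough for 21/55 to give the right
    integer part. *)
Definition zorbit (k : nat) : zalpha := (- (21 * k %/ 55)%N%:Z, k%:Z).
Arguments zorbit : simpl never.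

Definition seen_at (s : seq tile) (m n : nat) : bool :=
  all2 (fun u (k : nat * nat) => in_box (cell u) (zorbit (m + k.1), zorbit (n + k.2)))
    s [:: (0, 0); (1, 0); (0, 1); (1, 1)]%N.
Lemma seen_atP u v x y m n : seen_at [:: u; v; x; y] m n ->
  [/\ in_box (cell u) (zorbit (m + 0), zorbit (n + 0)),
      in_box (cell v) (zorbit (m + 1), zorbit (n + 0)),
      in_box (cell x) (zorbit (m + 0), zorbit (n + 1)) &
      in_box (cell y) (zorbit (m + 1), zorbit (n + 1))].
Proof.
by move=> /and5P[s0 s1 s2 s3 _]; split; [exact s0 | exact s1 | exact s2 | exact s3].
Qed.

(** One position for each of the 50 patterns of two by two tiles, all of them
    off the boundaries of the cells, along the orbit of the origin. *)
Definition seed_positions : seq (nat * nat) :=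
  [:: (3, 4); (3, 5); (3, 6); (3, 7); (3, 8); (3, 10); (3, 11); (4, 5); (4,
      6); (4, 7); (4, 8); (4, 9); (4, 10); (4, 11); (4, 12); (4, 17); (5,
      5); (5, 6); (5, 7); (5, 8); (5, 9); (5, 10); (5, 11); (5, 12); (5,
      16); (5, 17); (6, 6); (6, 12); (6, 13); (6, 17); (6, 18); (7, 2); (7,
      6); (7, 7); (7, 8); (7, 9); (7, 12); (7, 13); (7, 14); (7, 16); (7,
      17); (8, 7); (8, 8); (8, 9); (9, 9); (9, 20); (9, 28); (10, 20); (12,
      12); (12, 14)]%N.
Definition seen (s : seq tile) : bool :=
  has (fun k => seen_at s k.1 k.2) seed_positions.

Arguments entry : simpl never.
Definition central_tiles (p : seq (seq tile)) : seq tile :=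
  [:: entry p 1 1; entry p 2 1; entry p 1 2; entry p 2 2].

Lemma centers_seen : all seen (undup (map central_tiles (patches 5 4))).
Proof. by vm_compute. Qed.

(** * Every pattern of a tiling is realized *)

Section realize.
Context (R : realType).
Local Notation a := (alpha R).

Definition fpart (x : R) : R := x - (Num.floor x)%:~R.

Lemma fpart_eq (x y : R) (n : int) : 0 < y < 1 -> x = y + n%:~R -> fpart x = y.
Proof.
move=> /andP[y0 y1] ->; rewrite /fpart (@floor_def _ _ n) ?addrK //.
by rewrite intrD; apply/andP; split; lra.
Qed.

Lemma fpartP (x : R) : exists n : int, x = fpart x + n%:~R.
Proof. by exists (Num.floor x); rewrite /fpart subrK. Qed.

Definition in_cell (u : tile) (z : R * R) : Prop :=
  open_box R (cell u) (fpart z.1, fpart z.2).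

Definition realized (w : int * int -> tile) (o : int * int) (m n : nat) :=
  exists z : R * R, forall i j, (i < m)%N -> (j < n)%N ->
    in_cell (w (o.1 + i%:Z, o.2 + j%:Z)) (z.1 + i%:R * a, z.2 + j%:R * a).

Definition in_range (p : bool) (x : R) : Prop :=
  if p then a < x < 1 else 0 < x < a.

Lemma in_range01 p x : in_range p x -> 0 < x < 1.
Proof.
have [a0 a1] := (alpha_gt0 R, alpha_lt1 R).
by case: p => /andP[x0 x1]; apply/andP; split; lra.
Qed.

Lemma cell_range u z : u \in tiles_U -> open_box R (cell u) z ->
  in_range (wide u) z.1 /\ in_range (tall u) z.2.
Proof.
move=> uT zu; have /andP[i0 i1] := allP cell_interval _ uT.
have /andP[l0 h0] := zu 0%N isT; have /andP[l1 h1] := zu 1%N isT.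
have e1 : ev R (1, 0) = 1 by rewrite ev_int.
have e0 : ev R (0, 0) = 0 by rewrite ev_int.
have ea : ev R (0, 1) = a by rewrite ev_alpha mul1r.
have H p (l h : zalpha) x : in_interval p (l, h) -> ev R l < x -> x < ev R h -> in_range p x.
  by case: p => /andP[/(zle_ev R) /= + /(zle_ev R) /=]; rewrite ?e1 ?ea ?e0 /in_range; lra.
by split; [exact: (H _ _ _ _ i0) | exact: (H _ _ _ _ i1)].
Qed.

Lemma seed_realized w o m n : Omega_U w -> (m <= 2)%N -> (n <= 2)%N ->
  realized w o m n.
Proof.
move=> Ow m2 n2.
have pP := Omega_patch w (o.1 - 1, o.2 - 1) 5 4 Ow.
have : seen (central_tiles (patch_at w (o.1 - 1, o.2 - 1) 5 4)).
  by apply: (allP centers_seen); rewrite mem_undup; apply: map_f.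
have E i j : (i < 2)%N -> (j < 2)%N ->
    entry (patch_at w (o.1 - 1, o.2 - 1) 5 4) i.+1 j.+1 = w (o.1 + i%:Z, o.2 + j%:Z).
  by move=> i2 j2; rewrite entry_patch /=; [congr (w (_, _)); lia | lia | lia].
rewrite /central_tiles (E 0%N 0%N isT isT) (E 1%N 0%N isT isT).
rewrite (E 0%N 1%N isT isT) (E 1%N 1%N isT isT) {E pP}.
move=> /hasP[[k l] _ /seen_atP[s0 s1 s2 s3]].
exists (k%:R * a, l%:R * a) => i j im jn.
have : in_box (cell (w (o.1 + i%:Z, o.2 + j%:Z))) (zorbit (k + i), zorbit (l + j)).
  have i2 : (i < 2)%N by exact: leq_trans im m2.
  have j2 : (j < 2)%N by exact: leq_trans jn n2.
  move: j j2 {im jn}; move: i i2.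
  case=> [|[|i]] i2; [ | | by exfalso; clear - i2];
    (case=> [|[|j]] j2; [ | | by exfalso; clear - j2]).
  - exact s0.
  - exact s2.
  - exact s1.
  - exact s3.
move=> {s0 s1 s2 s3} /(in_boxP R) zb.
have uT : w (o.1 + i%:Z, o.2 + j%:Z) \in tiles_U by have [wT _ _] := Ow; exact: wT.
have [/in_range01 r1 /in_range01 r2] := cell_range _ _ uT zb.
have F p q : p%:R * a + q%:R * a =
    ev R (zorbit (p + q)) + ((21 * (p + q) %/ 55)%N%:Z)%:~R.
  by rewrite /zorbit /ev /= intrN -!pmulrn natrD; ring.
by rewrite /in_cell /= (fpart_eq _ _ _ r1 (F k i)) (fpart_eq _ _ _ r2 (F l j)).
Qed.

Definition contract (p : bool) (x : R) : R :=
  (if p then 2 - 2 * a else 1 - a) - (1 - a) * x.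

(** A step of the translation by [alpha] wraps around the circle exactly when it
    lands in the narrow range.  Because of this the contracted point moves,
    modulo 1, by [alpha] times the width of the block: a step between tiles
    becomes a step between blocks. *)
Lemma contract_orbit (p : nat -> bool) (x : R) (s : int -> int) m :
  (forall k : nat, s k.+1 = s k + 1 + (p k : nat)%:Z) ->
  (forall k, (k < m)%N -> in_range (p k) (fpart (x + k%:R * a))) ->
  forall k, (k < m)%N -> exists n : int,
    contract (p 0%N) (fpart x) + (s k - s 0%N)%:~R * a =
    contract (p k) (fpart (x + k%:R * a)) + n%:~R.
Proof.
move=> sS px; elim=> [|k IH] km.
  by exists 0; rewrite subrr !mul0r !addr0.
have [n IHn] := IH (ltnW km).
have := px _ (ltnW km); have := px _ km.
have [n0 E0] := fpartP (x + k%:R * a); have [n1 E1] := fpartP (x + k.+1%:R * a).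
move: E0 E1 IHn; set y0 := fpart (x + k%:R * a); set y1 := fpart (x + k.+1%:R * a).
move=> E0 E1 IHn r1 r0.
have a0 := alpha_gt0 R; have a1 := alpha_lt1 R; have aa := alpha_sqr R.
have E : y1 = y0 + a + (n0 - n1)%:~R.
  by move: E0 E1; rewrite -natr1 mulrDl mul1r intrB; lra.
(* [n0 - n1] is - 1 if the step wraps around the circle, and 0 otherwise *)
have d0 : - 1 <= n0 - n1 <= 0.
  have : (-2)%:~R < (n0 - n1)%:~R :> R /\ (n0 - n1)%:~R < 1%:~R :> R.
    have /andP[y00 y01] := in_range01 _ _ r0; have /andP[y10 y11] := in_range01 _ _ r1.
    have -> : (-2)%:~R = - 2 :> R by [].
    have -> : 1%:~R = 1 :> R by [].
    clear - E a0 a1 y00 y01 y10 y11; clearbody y0 y1.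
    by split; lra.
  by rewrite !ltr_int => -[? ?]; lia.
have {d0} d : n0 - n1 = - (~~ p k.+1 : nat)%:Z.
  have [d|d] : n0 - n1 = 0 \/ n0 - n1 = -1 by lia.
    rewrite d; case: (p k.+1) r1 => //=; rewrite E d addr0.
    by have /andP[? ?] := in_range01 _ _ r0; move=> /andP[_ h]; exfalso; lra.
  rewrite d; case: (p k.+1) r1 => //=; rewrite E d.
  by have /andP[? ?] := in_range01 _ _ r0; rewrite intrN => /andP[h _]; exfalso; lra.
exists (n + (p k : nat)%:Z).
have -> : (s k.+1 - s 0%N)%:~R = (s k - s 0%N)%:~R + 1 + (p k : nat)%:R :> R.
  by rewrite sS !intrD !intrN -!pmulrn; ring.
rewrite !mulrDl addrA addrA IHn E d.
case: (p k); case: (p k.+1); rewrite /contract /= ?intrB ?intrD ?intrN; ring: aa.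
Qed.

Lemma omega_cell (u : tile) (z : R * R) (i j : nat) :
  u \in tiles_U -> (i <= wide u)%N -> (j <= tall u)%N -> open_box R (cell u) z ->
  open_box R (cell (omega u i j))
    (contract (wide u) z.1 + i%:R * (a - 1), contract (tall u) z.2 + j%:R * (a - 1)).
Proof.
move=> uT iw jt zu.
have /allP h := allP cell_omega _ uT.
have ii : i \in iota 0 (width u) by rewrite mem_iota add0n ltnS.
have jj : j \in iota 0 (height u) by rewrite mem_iota add0n ltnS.
have /allP h' := h _ ii.
have /(subboxP R) s := h' _ jj.
have E p k (x : R) : - ((1 - a) * x) + ev R (block_shift p k) =
    contract p x + k%:R * (a - 1).
  rewrite /block_shift evD /contract; case: p; rewrite /ev /= !intrN -!pmulrn; ring.
have := s _ (move_boxP R _ _ _ (flip_boxP R _ _ zu)).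
by congr (open_box R _ _); rewrite -!E.
Qed.

(** If [z] realizes the pattern of blocks, then the contraction of [z] realizes
    the pattern that they cover. *)
Lemma realized_desubstitution w w' s t o m n m' n' :
  Omega_U w -> desubstitution w w' s t ->
  (forall i, (i < m)%N -> exists k : nat, exists e : nat,
      [/\ (k < m')%N, (e <= col_wide w' k)%N & o.1 + i%:Z = s k + e%:Z]) ->
  (forall j, (j < n)%N -> exists l : nat, exists f : nat,
      [/\ (l < n')%N, (f <= row_tall w' l)%N & o.2 + j%:Z = t l + f%:Z]) ->
  realized w' (0, 0) m' n' -> realized w o m n.
Proof.
move=> [wT _ _] D cov1 cov2 [z zP].
pose y (k : nat) := fpart (z.1 + k%:R * a).
pose v (l : nat) := fpart (z.2 + l%:R * a).
have Ow' := desub_Omega _ _ _ _ D; have [w'T _ _] := Ow'.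
have colE (k l : nat) : wide (w' (k%:Z, l%:Z)) = col_wide w' k.
  exact: wide_column.
have rowE (k l : nat) : tall (w' (k%:Z, l%:Z)) = row_tall w' l.
  exact: tall_row.
have box k l : (k < m')%N -> (l < n')%N -> open_box R (cell (w' (k%:Z, l%:Z))) (y k, v l).
  by move=> km ln; have := zP k l km ln; rewrite /= !add0r.
have sS (k : nat) : s k.+1 = s k + 1 + (col_wide w' k : nat)%:Z.
  by rewrite -addn1 PoszD (desub_colS _ _ _ _ D) /next_start (desub_wide _ _ _ _ D).
have tS (l : nat) : t l.+1 = t l + 1 + (row_tall w' l : nat)%:Z.
  by rewrite -addn1 PoszD (desub_rowS _ _ _ _ D) /next_start (desub_tall _ _ _ _ D).
exists (contract (col_wide w' 0) (fpart z.1) + (o.1 - s 0)%:~R * a,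
        contract (row_tall w' 0) (fpart z.2) + (o.2 - t 0)%:~R * a).
move=> i j im jn.
have [k [e [km ek oi]]] := cov1 _ im; have [l [f [ln fl oj]]] := cov2 _ jn.
have px k' : (k' < m')%N -> in_range (col_wide w' k') (y k').
  by move=> km'; have [+ _] := cell_range _ _ (w'T _) (box _ _ km' ln); rewrite colE.
have py l' : (l' < n')%N -> in_range (row_tall w' l') (v l').
  by move=> ln'; have [_ +] := cell_range _ _ (w'T _) (box _ _ km ln'); rewrite rowE.
have [c1 E1] := contract_orbit _ _ _ _ sS px k km.
have [c2 E2] := contract_orbit _ _ _ _ tS py l ln.
have ek' : (e <= wide (w' (k%:Z, l%:Z)))%N by rewrite colE.
have fl' : (f <= tall (w' (k%:Z, l%:Z)))%N by rewrite rowE.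
have zb := omega_cell _ _ _ _ (w'T _) ek' fl' (box _ _ km ln).
have wE : w (o.1 + i%:Z, o.2 + j%:Z) = omega (w' (k%:Z, l%:Z)) e f.
  by rewrite oi oj (desub_omega _ _ _ _ D).
have := wT (o.1 + i%:Z, o.2 + j%:Z); rewrite /= wE => oT.
have [/in_range01 r1 /in_range01 r2] := cell_range _ _ oT zb.
have F (x A : R) (c g h : int) (i' e' : nat) : g + i'%:Z = h + e'%:Z ->
    forall g0 : int, x + (h - g0)%:~R * a = A + c%:~R ->
    x + (g - g0)%:~R * a + i'%:R * a = A + e'%:R * (a - 1) + (c + e'%:Z)%:~R.
  move=> gh g0; have -> : g = h + e'%:Z - i'%:Z by lia.
  by rewrite !(intrD, intrN) -!pmulrn; lra.
rewrite /in_cell /=; move: r1 r2 zb; rewrite /= colE rowE => r1 r2 zb.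
by rewrite (fpart_eq _ _ _ r1 (F _ _ _ _ _ _ _ oi _ E1))
           (fpart_eq _ _ _ r2 (F _ _ _ _ _ _ _ oj _ E2)).
Qed.

(** Desubstitution reduces any pattern to one of at most two by two tiles, which
    the orbit of the origin realizes; contractions lead back. *)
Lemma Omega_realized w o m n : Omega_U w -> realized w o m n.
Proof.
have big k c x : fits (k + 2) c x k.
  by rewrite /fits; case: ifP => // _; case: ifP => [/eqP ->|_]; [case: ifP | lia].
have mono N N' c x k : (N <= N')%N -> fits N c x k -> fits N' c x k.
  by move=> NN; rewrite /fits; case: ifP => // _; case: ifP => _; [case: ifP | ]; lia.
move=> Ow; suff H N : forall w o m n, Omega_U w ->
    fits N (col_wide w) o.1 m -> fits N (row_tall w) o.2 n -> realized w o m n.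
  apply: (H (m + n + 2)%N) => //; [apply: mono (big m _ _) | apply: mono (big n _ _)]; lia.
elim: N {w o m n Ow} => [|N IH] w o m n Ow fm fn.
  apply: seed_realized => //.
    by move: fm; rewrite /fits; case: leqP => // m2; case: ifP => _; [case: ifP | lia].
  by move: fn; rewrite /fits; case: leqP => // m2; case: ifP => _; [case: ifP | lia].
have [w' [s [t [D so to]]]] := Omega_desubstitution w o Ow.
have Ow' := desub_Omega _ _ _ _ D.
have cE : (fun k => ~~ col_wide w (s k + 1)) = col_wide w'.
  by apply/funext => k; rewrite (desub_wide _ _ _ _ D).
have rE : (fun l => ~~ row_tall w (t l + 1)) = row_tall w'.
  by apply/funext => l; rewrite (desub_tall _ _ _ _ D).
have := block_cover (col_wide w) o.1 s N m; rewrite /= cE => /(_ _ _ _ _ so fm).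
case=> [||||m' fm' cov1].
- by move=> i; exact: (wide_isolated w i 0 Ow).
- by move=> i; rewrite -!(desub_wide _ _ _ _ D); exact: (wide_isolated w' i 0 Ow').
- exact: desub_col D.
- exact: desub_colS D.
have := block_cover (row_tall w) o.2 t N n; rewrite /= rE => /(_ _ _ _ _ to fn).
case=> [||||n' fn' cov2].
- by move=> i; exact: (tall_isolated w 0 i Ow).
- by move=> i; rewrite -!(desub_tall _ _ _ _ D); exact: (tall_isolated w' 0 i Ow').
- exact: desub_row D.
- exact: desub_rowS D.
apply: (realized_desubstitution _ _ _ _ _ _ _ m' n' Ow D).
- by move=> i /cov1[k [e [km ek oE]]]; exists k, e; split=> //; rewrite (desub_wide _ _ _ _ D).
- by move=> i /cov2[k [e [km ek oE]]]; exists k, e; split=> //; rewrite (desub_tall _ _ _ _ D).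
exact: IH.
Qed.

End realize.

(** * The torus as a topological group *)

Section torus_group.
Context (R : realType).
Local Notation proj := (\pi_(torus R)%qT : R * R -> torus R).

Definition intv (k : int * int) : R * R := (k.1%:~R, k.2%:~R).

Lemma intvN k : intv (- k) = - intv k.
Proof. by rewrite /intv /= !intrN. Qed.

Lemma torus_projD (x y : R * R) : proj (x + y) = proj x + proj y.
Proof. exact: (raddfD (\pi_(torus R)%qT : R * R -> torus R)). Qed.

Lemma torus_projB (x y : R * R) : proj (x - y) = proj x - proj y.
Proof. exact: (raddfB (\pi_(torus R)%qT : R * R -> torus R)). Qed.

Lemma torus_proj_surj (p : torus R) : exists x, p = proj x.
Proof. by exists (repr p); rewrite reprK. Qed.

Lemma torus_proj_eq (x y : R * R) : proj x = proj y <-> exists k, x = y + intv k.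
Proof.
split.
  move=> /eqP; rewrite -Quotient.idealrBE => /andP[/= /intrP[k1 e1] /intrP[k2 e2]].
  exists (k1, k2); rewrite /intv /= -e1 -e2; case: x y {e1 e2} => [a b] [c d].
  by rewrite -[RHS]/(c + (a - c), d + (b - d)); congr pair; ring.
move=> [k ->]; apply/eqP; rewrite -Quotient.idealrBE addrAC subrr add0r.
by rewrite /intv; apply/andP; rewrite /= !intr_int.
Qed.

(** The preimage of the image of [U] is the union of the integer translates of
    [U]. *)
Lemma torus_proj_open (U : set (R * R)) : open U -> open (proj @` U).
Proof.
move=> oU; suff : open (proj @^-1` (proj @` U)) by [].
have -> : proj @^-1` (proj @` U) = \bigcup_k [set x | U (x - intv k)].
  apply/seteqP; split => [x [y Uy /torus_proj_eq[k yx]]|x [k _ Ux]] /=.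
    by exists (- k) => //=; rewrite intvN opprK -yx.
  by exists (x - intv k) => //; apply/torus_proj_eq; exists (- k); rewrite intvN.
apply: bigcup_open => k _.
have c : continuous (fun x : R * R => x - intv k).
  move=> x; apply: cvgB; [exact: cvg_id | exact: cvg_cst].
exact: (open_comp (fun x _ => c x) oU).
Qed.

Lemma torus_proj_continuous : continuous (proj : R * R -> torus R).
Proof. by apply/continuousP => A oA. Qed.

Lemma sub_torus_continuous : continuous (fun x : torus R * torus R => x.1 - x.2).
Proof.
move=> [p q]; have [a ->] := torus_proj_surj p; have [b ->] := torus_proj_surj q.
move=> U /=; rewrite -torus_projB => /torus_proj_continuous UV.
have c : {for (a, b), continuous (fun x : (R * R) * (R * R) => x.1 - x.2)}.
  by apply: cvgB; [exact: cvg_fst | exact: cvg_snd].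
have [[A B] [/= nA nB] AB] := c _ UV.
exists (proj @` A, proj @` B) => /=.
  split.
    move: nA; rewrite !nbhsE => -[A' [oA' A'a] A'A]; exists (proj @` A').
      by split; [exact: torus_proj_open | exists a].
    exact: image_subset.
  move: nB; rewrite !nbhsE => -[B' [oB' B'b] B'B]; exists (proj @` B').
    by split; [exact: torus_proj_open | exists b].
  exact: image_subset.
move=> [_ _] /= [[x Ax <-] [y By <-]]; rewrite -torus_projB.
exact: (AB (x, y)).
Qed.

HB.instance Definition _ := PreTopologicalNmodule_isTopologicalZmodule.Build
  (torus R) sub_torus_continuous.

Lemma torus_hausdorff : hausdorff_space (torus R).
Proof.
rewrite open_hausdorff => p q.
have [a ->] := torus_proj_surj p; have [b ->] := torus_proj_surj q.
move=> /eqP ab.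
have far (r : R) : r \isn't a Num.int -> exists2 e : R, 0 < e &
    forall (x y : R) (n : int), `|x| < e -> `|y| < e -> r + x - y != n%:~R.
  move=> rN; have /andP[f1 f2] := floor_itv r.
  have f1' : (Num.floor r)%:~R < r.
    by rewrite lt_neqAle f1 andbT; apply: contraNneq rN => <-; rewrite intr_int.
  exists (Num.min (r - (Num.floor r)%:~R) ((Num.floor r + 1)%:~R - r) / 2).
    by rewrite divr_gt0 // lt_min !subr_gt0 f1' f2.
  move=> x y n; rewrite !ltr_norml => /andP[x1 x2] /andP[y1 y2]; apply/eqP => E.
  have m1 : Num.min (r - (Num.floor r)%:~R) ((Num.floor r + 1)%:~R - r) <=
      r - (Num.floor r)%:~R.
    by rewrite ge_min lexx.
  have m2 : Num.min (r - (Num.floor r)%:~R) ((Num.floor r + 1)%:~R - r) <=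
      (Num.floor r + 1)%:~R - r.
    by rewrite ge_min lexx orbT.
  have : (Num.floor r)%:~R < n%:~R :> R by lra.
  have : n%:~R < (Num.floor r + 1)%:~R :> R by lra.
  by rewrite !ltr_int; lia.
have [e e0 eP] : exists2 e : R, 0 < e & forall (x y : R * R) k,
    `|x.1| < e -> `|x.2| < e -> `|y.1| < e -> `|y.2| < e -> a + x <> b + y + intv k.
  have : a - b \notin Z2 R.
    by apply/negP; rewrite Quotient.idealrBE => /eqP; exact: ab.
  rewrite negb_and => /orP[/far[e e0 eP]|/far[e e0 eP]]; exists e => // x y k x1 x2 y1 y2 E.
    move/(congr1 fst): E => /= E; have /eqP := eP x.1 y.1 k.1 x1 y1; apply.
    by rewrite -[(a - b).1]/(a.1 - b.1); lra.
  move/(congr1 snd): E => /= E; have /eqP := eP x.2 y.2 k.2 x2 y2; apply.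
  by rewrite -[(a - b).2]/(a.2 - b.2); lra.
exists (proj @` (ball a e), proj @` (ball b e)) => /=.
  by split; rewrite inE; [exists a | exists b] => //; exact: ballxx.
split; [exact/torus_proj_open/ball_open | exact/torus_proj_open/ball_open|].
apply/eqP/seteqP; split => // _ [[x xa <-] [y yb /esym/torus_proj_eq[k xy]]].
move: xa yb => [x1 x2] [y1 y2]; apply: (eP (x - a) (y - b) k) => //=.
- by rewrite distrC.
- by rewrite distrC.
- by rewrite distrC.
- by rewrite distrC.
by rewrite addrC subrK [b + _]addrC subrK.
Qed.

Lemma torus_compact : compact [set: torus R].
Proof.
have -> : [set: torus R] = proj @` (`[0, 1] `*` `[0, 1]).
  apply/seteqP; split => // p _; have [a ->] := torus_proj_surj p.
  exists (fpart R a.1, fpart R a.2).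
    have fl x : fpart R x \in `[0, 1].
      rewrite in_itv /= /fpart; have /andP[] := floor_itv x.
      by rewrite intrD; lra.
    by split; exact: fl.
  apply/torus_proj_eq; exists (- Num.floor a.1, - Num.floor a.2).
  by rewrite /intv /= !intrN; case: a.
apply: continuous_compact.
  by apply: continuous_subspaceT => x; exact: torus_proj_continuous.
by apply: compact_setX; exact: segment_compact.
Qed.

End torus_group.

(** * The cut and project scheme *)

Section cut_and_project.
Context (R : realType).
Local Notation a := (alpha R).
Local Notation proj := (\pi_(torus R)%qT : R * R -> torus R).

Definition orbit (n : int * int) : torus R := proj (n.1%:~R * a, n.2%:~R * a).

Lemma R_UE n (x : torus R) : R_U n x = x + orbit n.
Proof. by rewrite /R_U /orbit !mulrzl. Qed.

Lemma orbitB m n : orbit (m - n) = orbit m - orbit n.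
Proof. by rewrite /orbit -torus_projB /= !intrB !mulrBl. Qed.

Lemma orbit0 : orbit 0 = 0.
Proof. by rewrite -(subrr 0) orbitB subrr. Qed.

Lemma orbitN n : orbit (- n) = - orbit n.
Proof. by rewrite -sub0r orbitB orbit0 sub0r. Qed.

Lemma orbitD m n : orbit (m + n) = orbit m + orbit n.
Proof. by rewrite -{1}[n]opprK orbitB orbitN opprK. Qed.

(** The powers of [1 - alpha = 1 / phi] are small positive elements of
    [Z[alpha]], the reason why [Z[alpha]] is dense. *)
Lemma ev_expr k : exists z : zalpha, ev R z = (1 - a) ^+ k.
Proof.
elim: k => [|k [z IH]]; first by exists (1, 0); rewrite ev_int.
exists (zmul (1, -1) z); rewrite evM IH exprS /ev /=; ring.
Qed.

Lemma zalpha_dense (x e : R) : 0 < e -> exists z : zalpha, `|x - ev R z| < e.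
Proof.
move=> e0; have a0 := alpha_gt0 R; have a1 := alpha_lt1 R.
have [k ke] : exists k, (1 - a) ^+ k < e.
  have : `|1 - a| < 1 by rewrite ger0_norm; lra.
  move=> /cvg_expr /cvgrPdist_lt /(_ _ e0) [k _ kP]; exists k.
  have := kP k (leqnn k); rewrite /= sub0r normrN ger0_norm // exprn_ge0 //; lra.
have [z zE] := ev_expr k; have d0 : 0 < (1 - a) ^+ k by rewrite exprn_gt0 //; lra.
set d := (1 - a) ^+ k in ke zE d0; have /andP[f1 f2] := floor_itv (x / d).
exists (zmul (Num.floor (x / d), 0) z); rewrite evM zE ev_int.
move: f1 f2; rewrite ler_pdivlMr // ltr_pdivrMr // intrD mulrDl mul1r => f1 f2.
by rewrite ger0_norm; lra.
Qed.

Lemma orbit_dense : dense (range orbit).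
Proof.
move=> O [p Op] oO; have [x xE] := torus_proj_surj _ p; subst p.
have : nbhs x (proj @^-1` O).
  exact: (torus_proj_continuous R x O (open_nbhs_nbhs (conj oO Op))).
move=> /nbhs_ballP[e /= e0 eO].
have [z1 z1P] := zalpha_dense x.1 _ e0; have [z2 z2P] := zalpha_dense x.2 _ e0.
exists (orbit (z1.2, z2.2)); split; last by exists (z1.2, z2.2).
have -> : orbit (z1.2, z2.2) = proj (ev R z1, ev R z2).
  apply/torus_proj_eq; exists (- z1.1, - z2.1); rewrite /intv /ev /= !intrN.
  by rewrite -[RHS]/((_ + _) - _, (_ + _) - _); congr pair; ring.
exact: eO.
Qed.

Lemma embed_inj : injective (embed R).
Proof.
move=> [m1 m2] [n1 n2] /rowP E.
have := E ord0; have := E (lift ord0 ord0); rewrite !mxE /= => /intr_inj -> /intr_inj ->.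
by [].
Qed.

Lemma embedB m n : embed R (m - n) = embed R m - embed R n.
Proof. by apply/rowP => i; rewrite !mxE; case: ifP => _; rewrite -intrB. Qed.

Definition torus_lattice : set ('rV[R]_2 * torus R)%type :=
  range (fun n => (embed R n, orbit n)).

Lemma torus_lattice_subgroup : subgroup torus_lattice.
Proof.
split.
  exists 0 => //; rewrite orbit0; congr pair; apply/rowP => i; rewrite !mxE; by case: ifP.
by move=> _ _ [m _ <-] [n _ <-]; exists (m - n) => //; rewrite orbitB embedB.
Qed.

Lemma torus_lattice_isolated : torus_lattice `<=` isolated torus_lattice.
Proof.
move=> _ [n _ <-]; split; first by rewrite inE; exists n.
exists (ball (embed R n) 1 `*` setT).
  exists (ball (embed R n) 1, setT) => //=; split; [exact: nbhsx_ballx|exact: filterT].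
apply/seteqP; split=> [[v h] [[/= b _] [m _ [vE hE]]]|_ ->]; last first.
  by split; [split => //; exact: ballxx | exists n].
have near (x y : int) : `|x%:~R - y%:~R : R| < 1 -> x = y.
  by rewrite -intrB -intr_norm ltrz1; lia.
suff mn : m = n by rewrite -vE -hE mn.
rewrite -vE in b.
have /= := b.2 ord0 (lift ord0 ord0); have /= := b.2 ord0 ord0.
rewrite /ball /= !mxE /= => /near + /near.
by case: m n {b vE hE} => [m1 m2] [n1 n2] /= -> ->.
Qed.

Lemma torus_lattice_cocompact :
  exists2 K : set ('rV[R]_2 * torus R)%type, compact K &
    forall x, exists2 l, torus_lattice l & exists2 k, K k & x = l + k.
Proof.
exists ([set v : 'rV[R]_2 | forall i, `[0, 1]%classic (v ord0 i)] `*` setT).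
  apply: compact_setX; last exact: torus_compact.
  by apply: (@rV_compact R 2 (fun=> `[0, 1]%classic)) => i; exact: segment_compact.
move=> [v h]; pose n := (Num.floor (v ord0 ord0), Num.floor (v ord0 (lift ord0 ord0))).
exists (embed R n, orbit n); first by exists n.
exists (v - embed R n, h - orbit n); last first.
  by rewrite -[RHS]/(_ + (v - _), _ + (h - _)) ![_ + (_ - _)]addrC !subrK.
split => //= i; rewrite in_itv /= !mxE.
have fl (x : R) : (0 <= x - (Num.floor x)%:~R) && (x - (Num.floor x)%:~R <= 1).
  by have /andP[] := floor_itv x; rewrite intrD; lra.
case: ifP => [/eqP -> //|]; case: i => [[|[|//]] //= i2] _.
by rewrite (_ : Ordinal i2 = lift ord0 ord0) ?fl //; apply: val_inj.
Qed.

Lemma torus_locally_compact : locally_compact [set: torus R].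
Proof.
move=> p _; rewrite withinET; exists setT; first exact: filterT.
by split; [exact: torus_compact | exact: closedT].
Qed.

Lemma torus_compactly_generated : compactly_generated (torus R).
Proof.
exists setT; first exact: torus_compact.
by move=> G _ G1; apply/seteqP; split.
Qed.

Lemma torus_lattice_injective : {in torus_lattice &, injective fst}.
Proof.
by move=> x y; rewrite !inE => -[m _ <-] [n _ <-] /= /embed_inj ->.
Qed.

Lemma torus_lattice_dense : dense (snd @` torus_lattice).
Proof.
have -> : snd @` torus_lattice = range orbit.
  apply/seteqP; split=> [_ [_ [n _ <-] <-]|_ [n _ <-]]; first by exists n.
  by exists (embed R n, orbit n) => //; exists n.
exact: orbit_dense.
Qed.

Definition torus_scheme : cut_and_project R 2 :=
  @CutAndProject R 2 (torus R) torus_lattice (torus_hausdorff R)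
    torus_locally_compact torus_compactly_generated
    (And3 torus_lattice_subgroup torus_lattice_isolated torus_lattice_cocompact)
    torus_lattice_injective torus_lattice_dense.

Lemma star_embed n : star torus_scheme (embed R n) = orbit n.
Proof.
rewrite /star; case: xgetP => [z _ [[m _ <-] /= /embed_inj -> //]|].
by move=> /(_ (embed R n, orbit n)) []; split => //; exists n.
Qed.

Lemma curlywedgeE (A : set (torus R)) :
  @curlywedge R 2 torus_scheme A = embed R @` [set n | A (orbit n)].
Proof.
apply/seteqP; split=> [x [[_ [n _ <-] <-]]|_ [n An <-]] /=.
  by rewrite star_embed => An; exists n.
split; last by rewrite star_embed.
by exists (embed R n, orbit n) => //; exists n.
Qed.

Lemma star_range : star torus_scheme @` projected_lattice torus_scheme = range orbit.
Proof.
apply/seteqP; split=> [_ [_ [_ [n _ <-] <-] <-]|_ [n _ <-]].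
  by exists n => //; rewrite star_embed.
exists (embed R n); last by rewrite star_embed.
by exists (embed R n, orbit n) => //; exists n.
Qed.

End cut_and_project.

(** * Planar Lebesgue measure *)

Section plane.
Context (R : realType).
Local Notation R1 := (measurableTypeR R).
Local Notation R2 := (measurableTypeR R * measurableTypeR R)%type.
Local Notation leb := (@lebesgue_measure R).
Local Notation leb2 := (@lebesgue_measure R \x @lebesgue_measure R)%E.

(** Closed boxes, so that their images in the torus are compact. *)
Definition rbox (q : rat * rat * rat) : set (R * R) :=
  `[ratr q.1.1 - ratr q.2, ratr q.1.1 + ratr q.2]%classic `*`
  `[ratr q.1.2 - ratr q.2, ratr q.1.2 + ratr q.2]%classic.

Lemma open_rbox (V : set (R * R)) : open V ->
  V = \bigcup_(q in [set q | rbox q `<=` V]) rbox q.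
Proof.
move=> oV; apply/seteqP; split=> [x Vx|x [q qV /qV] //].
have : nbhs x V by exact: open_nbhs_nbhs.
move=> /nbhs_ballP[e /= e0 eV].
have [|r rP] := @rat_in_itvoo _ 0 (e / 2); first by rewrite divr_gt0.
move: rP; rewrite in_itv /= => /andP[r0 re].
have near (t : R) : exists q : rat, t - ratr r < ratr q < t + ratr r.
  have [|q qP] := @rat_in_itvoo _ (t - ratr r) (t + ratr r); first by lra.
  by exists q; move: qP; rewrite in_itv.
have [q1 /andP[a1 b1]] := near x.1; have [q2 /andP[a2 b2]] := near x.2.
exists (q1, q2, r) => /=; last first.
  by split; rewrite /= in_itv /=; apply/andP; split; lra.
move=> y [] /=; rewrite !in_itv /= => /andP[y1 y1'] /andP[y2 y2'].
by apply: eV; split; rewrite /ball /= ltr_norml; apply/andP; split; lra.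
Qed.

Lemma open_measurable2 (V : set R2) : open (V : set (R * R)) -> measurable V.
Proof.
move=> /open_rbox ->; rewrite bigcup_mkcond.
apply: countable_bigcupT_measurable; first exact: countableP.
move=> q; case: ifP => _; last exact: measurable0.
by apply: measurableX; exact: measurable_itv.
Qed.

Lemma closed_measurable2 (V : set R2) : closed (V : set (R * R)) -> measurable V.
Proof.
move=> cV; rewrite -[V]setCK; apply: measurableC.
by apply: open_measurable2; exact: closed_openC.
Qed.

(** Translation preserves lengths of intervals, which determine the measure. *)
Lemma lebesgue_translation (t : R) (A : set R1) : measurable A ->
  leb ((fun x => x + t) @^-1` A) = leb A.
Proof.
move=> mA; have mt : measurable_fun [set: R1] ((fun x => x + t) : R1 -> R1).
  exact: measurable_funD.
rewrite -[LHS]/(pushforward leb ((fun x => x + t) : R1 -> R1) A).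
apply/esym/(@lebesgue_measure_unique R (pushforward leb ((fun x => x + t) : R1 -> R1))) => //.
move=> _ [[a b]] _ <-; rewrite /pushforward /=.
rewrite [X in _ = leb X](_ : _ = `]a - t, b - t]%classic); last first.
  by apply/seteqP; split => x /=; rewrite !in_itv /= ltrBlDr lerBrDr.
rewrite !lebesgue_measure_itv /= !lte_fin ltrD2r; case: ifP => // _.
by rewrite -!EFinB; congr EFin; ring.
Qed.

Lemma measurable_translation2 (t : R * R) :
  measurable_fun [set: R2] ((fun z => (z.1 + t.1, z.2 + t.2)) : R2 -> R2).
Proof.
apply: measurable_fun_pair; apply: measurable_funD => //;
  exact: measurable_fst || exact: measurable_snd.
Qed.

Lemma leb2_translation (t : R * R) (A : set R2) : measurable A ->
  leb2 ((fun z : R2 => (z.1 + t.1, z.2 + t.2) : R2) @^-1` A) = leb2 A.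
Proof.
move=> mA; pose f : R2 -> R2 := fun z => (z.1 + t.1, z.2 + t.2).
have mf : measurable_fun [set: R2] f by exact: measurable_translation2.
rewrite -[LHS]/(pushforward leb2 f A).
apply/esym; apply: (@product_measure_unique _ _ R1 R1 R leb leb (pushforward leb2 f)) => //.
move=> X Y mX mY; rewrite /pushforward.
transitivity (leb2 (((fun x : R1 => (x + t.1 : R1)) @^-1` X) `*`
  ((fun x : R1 => (x + t.2 : R1)) @^-1` Y))); first by [].
have mt (s : R) : measurable_fun [set: R1] ((fun x => x + s) : R1 -> R1).
  exact: measurable_funD.
rewrite product_measure1E.
- by congr (_ * _)%E; exact: lebesgue_translation.
- by rewrite -[X in measurable X]setTI; exact: mt.
- by rewrite -[X in measurable X]setTI; exact: mt.
Qed.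

Lemma form_continuous d : continuous (form R d).
Proof.
case: d => [|[|[|d]]] z.
- exact: cvg_fst.
- exact: cvg_snd.
- by apply: cvgD; [exact: cvg_fst | exact: cvg_snd].
- apply: cvgD; last exact: cvg_snd.
  by apply: cvgM; [exact: cvg_cst | exact: cvg_fst].
Qed.

(** Vertical lines are products with a point; any other line meets each vertical
    line in one point. *)
Lemma line_null d c : leb2 ([set z | form R d z = c] : set R2) = 0%E.
Proof.
case: d => [|d].
  have -> : [set z | form R 0 z = c] = ([set c] `*` setT : set R2).
    by apply/seteqP; split => [z /= ->|z [/= -> _]].
  rewrite product_measure1E //.
  by rewrite [X in (X * _)%E](_ : _ = 0%E) ?mul0e //; exact: lebesgue_measure_set1.
rewrite /product_measure1 integral0_eq //= => x _.
have [y yP] : exists y, xsection ([set z | form R d.+1 z = c] : set R2) x `<=` [set y].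
  pose k : R := if d is d'.+1 then (if d' is 0%N then x else phi R * x) else 0.
  exists (c - k) => y /xsectionP; rewrite /k; case: d {k} => [|[|d]] /= <-; ring.
apply/eqP; rewrite eq_le measure_ge0 andbT -(lebesgue_measure_set1 y).
apply: le_measure => //; rewrite inE; last exact: measurable_set1.
apply: measurable_xsection; apply: closed_measurable2.
by apply: (@closed_comp _ _ (form R d.+1) [set c]) => // z _; exact: form_continuous.
Qed.

End plane.

(** * Regularity of finite Borel measures *)

Section regularity.
Context (R : realType) (H : topologicalZmodType).
Context (mu : {measure set (borel H) -> \bar R}).

Lemma borel_open (U : set H) : open U -> measurable (U : set (borel H)).
Proof. by move=> oU; exact: sub_sigma_algebra. Qed.

Lemma borel_closed (F : set H) : closed F -> measurable (F : set (borel H)).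
Proof.
move=> cF; rewrite -[F]setCK; apply: (@measurableC _ (borel H)).
by apply: borel_open; exact: closed_openC.
Qed.

(** The sets with this property form a sigma-algebra, which contains the open
    sets as soon as these are countable unions of closed sets. *)
Definition approximable (B : set H) := forall e : R, 0 < e ->
  exists F U : set H, [/\ closed F, open U, F `<=` B, B `<=` U &
    (mu (U `\` F : set (borel H)) < e%:E)%E].

Hypothesis mu_fin : (mu setT < +oo)%E.

(** A finite measure is continuous along the decreasing sequence of
    remainders. *)
Lemma closed_union_approx (F : nat -> set H) (e : R) :
  (forall n, closed (F n)) -> 0 < e ->
  exists N, (mu ((\bigcup_n F n) `\` \big[setU/set0]_(i < N) F i : set (borel H)) < e%:E)%E.
Proof.
move=> cF e0.
pose G N : set (borel H) := (\bigcup_n F n) `\` \big[setU/set0]_(i < N) F i.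
have mG N : measurable (G N).
  apply: (@measurableD _ (borel H)).
    by apply: (@bigcupT_measurable _ (borel H)) => n; exact: borel_closed.
  by apply: (@bigsetU_measurable _ (borel H)) => i _; exact: borel_closed.
have G0 : \bigcap_N G N = set0.
  apply/seteqP; split => // x Gx; have [[n _ Fx] _] := Gx 0%N I.
  have [_] := Gx n.+1 I; apply.
  by rewrite -bigcup_mkord; exists n => //=.
have := @nonincreasing_cvg_mu _ _ _ mu G _ mG _ _; rewrite G0 measure0.
case/(_ _ _ _ [set y | (y < e%:E)%E]).
- apply: le_lt_trans mu_fin; apply: le_measure => //; rewrite inE //; exact: measurableT.
- exact: measurable0.
- move=> m n mn; apply/subsetPset => x [x1 x2]; split => // x3; apply: x2.
  move: x3; rewrite -!bigcup_mkord => -[i /= im Fi]; exists i => //=.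
  exact: leq_trans im mn.
- apply: open_nbhs_nbhs; split; first exact: open_ereal_lt_ereal.
  by rewrite /= lte_fin.
by move=> N _ NP; exists N; apply: (NP N) => /=.
Qed.

Lemma approximable_setC (B : set H) : approximable B -> approximable (~` B).
Proof.
move=> aB e e0; have [F [U [cF oU FB BU m]]] := aB e e0.
exists (~` U), (~` F); split; [exact: open_closedC | exact: closed_openC | | |].
- exact: subsetC.
- exact: subsetC.
- by rewrite setDE setCK setIC -setDE.
Qed.

Lemma approximable_bigcup (B : nat -> set H) :
  (forall n, approximable (B n)) -> approximable (\bigcup_n B n).
Proof.
move=> aB e e0; have e2 : 0 < e / 2 by rewrite divr_gt0.
have d0 n : 0 < e / 2 / (2 ^ n.+1)%:R by rewrite divr_gt0 // ltr0n expn_gt0.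
have /choice[F FP] n : exists F : set H, exists U : set H,
    [/\ closed F, open U, F `<=` B n, B n `<=` U &
    (mu (U `\` F : set (borel H)) < (e / 2 / (2 ^ n.+1)%:R)%:E)%E].
  by have [F [U P]] := aB n _ (d0 n); exists F, U.
have /choice[U UP] := FP.
have [N mN] : exists N, (mu ((\bigcup_n F n) `\` \big[setU/set0]_(i < N) F i : set (borel H))
    < (e / 2)%:E)%E.
  by apply: closed_union_approx => // n; have [] := UP n.
have mUF n : measurable ((U n `\` F n) : set (borel H)).
  have [cF oU _ _ _] := UP n.
  by apply: (@measurableD _ (borel H)); [exact: borel_open | exact: borel_closed].
have mD : (mu (\bigcup_n (U n `\` F n) : set (borel H)) <= (e / 2)%:E)%E.
  apply: (le_trans (@measure_sigma_subadditive _ _ _ mu _ _ mUF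
    (@bigcupT_measurable _ (borel H) _ mUF) (@subset_refl _ _))).
  apply: le_trans (epsilon_trick0 xpredT (ltW e2)).
  by apply: lee_nneseries => // n _; have [_ _ _ _ /ltW] := UP n.
exists (\big[setU/set0]_(i < N) F i), (\bigcup_n U n); split.
- by apply: closed_bigsetU => i _; have [] := UP i.
- by apply: bigcup_open => i _; have [] := UP i.
- rewrite -bigcup_mkord => x [i _ Fx]; exists i => //.
  by have [_ _ FB _ _] := UP i; exact: FB.
- by move=> x [i _ Bx]; exists i => //; have [_ _ _ BU _] := UP i; exact: BU.
have mF : measurable (\big[setU/set0]_(i < N) F i : set (borel H)).
  by apply: borel_closed; apply: closed_bigsetU => i _; have [] := UP i.
have mbF : measurable (\bigcup_n F n : set (borel H)).
  by apply: (@bigcupT_measurable _ (borel H)) => n; apply: borel_closed; have [] := UP n.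
have mbUF := @bigcupT_measurable _ (borel H) _ mUF.
apply: (@le_lt_trans _ _ (mu ((\bigcup_n (U n `\` F n)) `|`
    ((\bigcup_n F n) `\` \big[setU/set0]_(i < N) F i) : set (borel H)))).
  apply: le_measure; rewrite ?inE.
  - apply: (@measurableD _ (borel H)) => //; apply: (@bigcupT_measurable _ (borel H)) => n.
    by apply: borel_open; have [] := UP n.
  - by apply: (@measurableU _ (borel H)) => //; exact: (@measurableD _ (borel H)).
  - move=> x [[n _ Ux] nF]; have [Fx|Fx] := pselect (exists m, F m x).
      by right; split => //; case: Fx => m Fm; exists m.
    by left; exists n => //; split => // Fn; apply: Fx; exists n.
have mDF := @measurableD _ (borel H) _ _ mbF mF.
apply: (le_lt_trans (measureU2 mu mbUF mDF)).
rewrite [e in (_ < e%:E)%E](splitr e) EFinD.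
by apply: (le_lt_trans (leeD2r _ mD)); rewrite lteD2lE.
Qed.

Hypothesis open_Fsigma : forall U : set H, open U ->
  exists F : nat -> set H, (forall n, closed (F n)) /\ U = \bigcup_n F n.

Lemma approximable_open (U : set H) : open U -> approximable U.
Proof.
move=> oU e e0; have [F [cF UF]] := open_Fsigma U oU.
have [N mN] := closed_union_approx F e cF e0.
exists (\big[setU/set0]_(i < N) F i), U; split => //.
- by apply: closed_bigsetU => i _.
- by rewrite UF -bigcup_mkord => x [i _ Fx]; exists i.
- by rewrite {1}UF.
Qed.

Lemma borel_approximable (B : set (borel H)) : measurable B -> approximable B.
Proof.
move: B; apply: smallest_sub; last by move=> U; exact: approximable_open.
split.
- by apply: approximable_open; exact: open0.
- by move=> B aB; rewrite setTD; exact: approximable_setC.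
- by move=> B aB; exact: approximable_bigcup.
Qed.

Lemma outer_regular (B : set (borel H)) : measurable B ->
  mu B = ereal_inf [set mu U | U in [set U : set H | open U /\ B `<=` U]].
Proof.
move=> mB; apply/eqP; rewrite eq_le; apply/andP; split.
  apply: le_ereal_inf_tmp => _ [U [oU BU] <-].
  by apply: le_measure => //; rewrite inE //; exact: borel_open.
apply/lee_addgt0Pr => e e0; have [F [U [cF oU FB BU mUF]]] := borel_approximable B mB e e0.
have mU := borel_open U oU; have mF := borel_closed F cF.
apply: (@le_trans _ _ (mu U)); first by apply: ereal_inf_lbound; exists U.
have -> : U = B `|` (U `\` B) by rewrite setDUK.
apply: (le_trans (measureU2 mu mB (@measurableD _ (borel H) _ _ mU mB))).
rewrite leeD2l //; apply: le_trans (ltW mUF); apply: le_measure; rewrite ?inE.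
- exact: (@measurableD _ (borel H)).
- exact: (@measurableD _ (borel H)).
- by move=> x [Ux nB]; split => // /FB.
Qed.

Hypothesis H_compact : compact [set: H].
Hypothesis H_hausdorff : hausdorff_space H.

Lemma inner_regular (U : set H) : open U ->
  mu U = ereal_sup [set mu K | K in [set K : set H | compact K /\ K `<=` U]].
Proof.
move=> oU; have mU := borel_open U oU; apply/eqP; rewrite eq_le; apply/andP; split.
  apply/lee_addgt0Pr => e e0.
  have [F [V [cF oV FU UV mVF]]] := borel_approximable U mU e e0.
  have mV := borel_open V oV; have mF := borel_closed F cF.
  apply: (@le_trans _ _ (mu F + e%:E)%E); last first.
    rewrite leeD2r //; apply: ereal_sup_ubound; exists F => //; split => //.
    exact: (subclosed_compact cF H_compact (@subsetT _ _)).
  have {1}-> : U = F `|` (U `\` F) by rewrite setDUK.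
  apply: (le_trans (measureU2 mu mF (@measurableD _ (borel H) _ _ mU mF))).
  rewrite leeD2l //; apply: le_trans (ltW mVF); apply: le_measure; rewrite ?inE.
  - exact: (@measurableD _ (borel H)).
  - exact: (@measurableD _ (borel H)).
  - by move=> x [Ux nF]; split => //; exact: UV.
apply: ge_ereal_sup => _ [K [cK KU] <-].
apply: le_measure => //; rewrite inE //; apply: borel_closed.
exact: compact_closed.
Qed.

End regularity.

(** * Haar measure of the torus *)

Section torus_measure.
Context (R : realType).
Local Notation R1 := (measurableTypeR R).
Local Notation R2 := (measurableTypeR R * measurableTypeR R)%type.
Local Notation leb2 := (@lebesgue_measure R \x @lebesgue_measure R)%E.
Local Notation proj := (\pi_(torus R)%qT : R * R -> torus R).
Local Notation a := (alpha R).

(** The images of the rational boxes are compact, hence closed. *)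
Lemma torus_open_Fsigma (U : set (torus R)) : open U ->
  exists F : nat -> set (torus R), (forall n, closed (F n)) /\ U = \bigcup_n F n.
Proof.
move=> oU; have oV : open (proj @^-1` U) by [].
pose F n : set (torus R) := if unpickle n is Some q then
  if asbool (rbox R q `<=` proj @^-1` U) then proj @` (rbox R q) else set0 else set0.
exists F; split.
  move=> n; rewrite /F; case: unpickle => [q|]; last exact: closed0.
  case: asboolP => _; last exact: closed0.
  apply: compact_closed; first exact: torus_hausdorff.
  apply: continuous_compact.
    by apply: continuous_subspaceT => x; exact: torus_proj_continuous.
  by apply: compact_setX; exact: segment_compact.
apply/seteqP; split=> [p Up|p [n _]].
  have [x xE] := torus_proj_surj _ p; subst p.
  have [q qV qx] : (\bigcup_(q in [set q | rbox R q `<=` proj @^-1` U]) rbox R q) x.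
    by have <- := open_rbox _ _ oV.
  exists (pickle q); first exact: I.
  rewrite /F pickleK asboolT; last exact: qV.
  by exists x.
rewrite /F; case: unpickle => [q|] //; case: asboolP => // qV [x qx <-].
exact: qV.
Qed.

Definition square : set R2 := `[0, 1[%classic `*` `[0, 1[%classic.

Lemma measurable_square : measurable square.
Proof. by apply: measurableX; exact: measurable_itv. Qed.

Definition to_borel (z : R2) : borel (torus R) := proj z.

Lemma measurable_to_borel : measurable_fun [set: R2] to_borel.
Proof.
apply: (@measurability _ _ R2 (borel (torus R)) _ _ (@open (torus R))) => //.
move=> _ [U oU <-]; rewrite setTI.
by apply: open_measurable2; exact: oU.
Qed.

(** The image of Lebesgue measure on the half-open unit square. *)
Definition torus_mu : {measure set (borel (torus R)) -> \bar R} :=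
  @measure_function_pushforward__canonical__measure_function_Measure
    _ _ R2 (borel (torus R)) R (mrestr leb2 measurable_square) to_borel
    measurable_to_borel.

Lemma torus_muE (B : set (borel (torus R))) :
  torus_mu B = leb2 ((to_borel @^-1` B) `&` square).
Proof. by []. Qed.

Definition band (c : R2 -> R) (x y : R) : set R2 := [set z | x <= c z < y].

(** Cut and paste: to move the band by [s] is to remove a piece at one end and to
    add, at the other end, its translate by the period [e]. *)
Lemma band_shift (c : R2 -> R) (e : R * R) (E : set R2) (u s : R) :
  (forall x y, measurable (band c x y)) -> measurable E ->
  (forall z : R * R, c (z + e) = c z + 1) ->
  (forall z : R * R, E (z + e) <-> E z) -> 0 <= s <= 1 ->
  leb2 (E `&` band c (u + s) (u + s + 1)) = leb2 (E `&` band c u (u + 1)).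
Proof.
move=> mc mE ce per /andP[s0 s1].
pose S (x y : R) : set R2 := E `&` band c x y.
have mS x y : measurable (S x y) by exact: measurableI.
have SU x y z : x <= y -> y <= z -> leb2 (S x z) = (leb2 (S x y) + leb2 (S y z))%E.
  move=> xy yz; rewrite -measureU //.
    congr (leb2 _); apply/seteqP; split=> [p [Ep /andP[xp pz]]|p [] [Ep /andP[xp pz]]].
    - by case: (ltP (c p) y) => py; [left | right]; split => //; apply/andP.
    - by split => //; apply/andP; split => //; exact: lt_le_trans yz.
    - by split => //; apply/andP; split => //; exact: le_trans xp.
  apply/seteqP; split => // p [[_ /andP[_ py]] [_ /andP[yp _]]].
  by move: py; rewrite ltNge yp.
rewrite -/(S (u + s) (u + s + 1)) -/(S u (u + 1)).
have [l1 l2 l3 l4] :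
    [/\ u + s <= u + 1, u + 1 <= u + s + 1, u <= u + s & u + s <= u + 1].
  by split; lra.
have shift : leb2 (S (u + 1) (u + s + 1)) = leb2 (S u (u + s)).
  rewrite -(leb2_translation R e _ (mS (u + 1) (u + s + 1))).
  congr (leb2 _); apply/seteqP; split => z [Ez /andP[uz zu]].
    by split; [exact/per | apply/andP; rewrite (ce z) in uz zu; split; lra].
  by split; [exact/per | apply/andP; rewrite (ce z); split; lra].
by rewrite (SU _ _ _ l1 l2) (SU _ _ _ l3 l4) shift addeC.
Qed.

Lemma fpart01 (x : R) : 0 <= fpart R x < 1.
Proof.
by rewrite /fpart; have /andP[] := floor_itv x; rewrite intrD; lra.
Qed.

Lemma torus_proj_unit (p : torus R) :
  exists2 c : R * R, p = proj c & (0 <= c.1 < 1) && (0 <= c.2 < 1).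
Proof.
have [x ->] := torus_proj_surj _ p.
exists (fpart R x.1, fpart R x.2); last by rewrite /= !fpart01.
apply/torus_proj_eq; exists (Num.floor x.1, Num.floor x.2).
by rewrite /intv /fpart; case: x => x y; rewrite -[RHS]/(_ + _, _ + _) !subrK.
Qed.

Lemma measurable_preimage_to_borel (B : set (borel (torus R))) :
  measurable B -> measurable (to_borel @^-1` B).
Proof. by move=> mB; rewrite -[X in measurable X]setTI; exact: measurable_to_borel. Qed.

Lemma to_borel_periodic (z : R * R) k : to_borel (z + intv R k) = to_borel z.
Proof. by apply/torus_proj_eq; exists k. Qed.

(** The preimage of a set in the plane is periodic, and the unit square translated
    by [c] goes back to the unit square in two moves along the axes. *)
Lemma torus_mu_invariant (h : torus R) (B : set (borel (torus R))) :
  measurable B -> torus_mu (translate h B) = torus_mu B.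
Proof.
move=> mB; have [c -> /andP[c1 c2]] := torus_proj_unit h.
have mE := measurable_preimage_to_borel B mB; set E := to_borel @^-1` B in mE.
have per k (z : R * R) : E (z + intv R k) <-> E z.
  by rewrite /E /= to_borel_periodic.
have tE (z : R * R) : (to_borel @^-1` translate (proj c) B) (z + c) = E z.
  apply/propext; split => [[p Bp pE]|Ez].
    rewrite /E /=; suff -> : to_borel z = p by [].
    by apply: (addrI (proj c)); rewrite pE -torus_projD addrC.
  by exists (to_borel z) => //; rewrite -torus_projD addrC.
have mT : measurable (to_borel @^-1` translate (proj c) B : set R2).
  rewrite (_ : _ @^-1` _ = (fun z : R2 => (z.1 + - c.1, z.2 + - c.2) : R2) @^-1` E).
    rewrite -[X in measurable X]setTI.
    by have := measurable_translation2 R (- c.1, - c.2); apply.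
  by apply/funext => z; rewrite -[RHS]/(E (z - c)) -tE subrK.
rewrite !torus_muE.
rewrite -(leb2_translation R c); last by apply: measurableI => //; exact: measurable_square.
pose X : set R2 -> R -> set R2 := fun F x => F `&` band fst x (x + 1).
pose Y : set R2 -> R -> set R2 := fun F y => F `&` band snd y (y + 1).
have mX x y : measurable (band fst x y).
  have -> : band fst x y = (`[x, y[%classic `*` setT : set R2).
    by apply/seteqP; split => z; rewrite /band /= in_itv //= => -[].
  by apply: measurableX => //; exact: measurable_itv.
have mY x y : measurable (band snd x y).
  have -> : band snd x y = (setT `*` `[x, y[%classic : set R2).
    by apply/seteqP; split => z; rewrite /band /= in_itv //= => -[].
  by apply: measurableX => //; exact: measurable_itv.
have squareE F : F `&` square = Y (X F 0) 0.
  by rewrite /X /Y !add0r -setIA; congr (F `&` _).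
transitivity (leb2 (Y (X E (- c.1)) (- c.2))).
  congr (leb2 _); apply/seteqP; split => z.
    move=> [Ez []]; rewrite /= !in_itv /= => /andP[? ?] /andP[? ?].
    by split; [split; [rewrite -tE | apply/andP; split; lra] | apply/andP; split; lra].
  move=> [[Ez /andP[? ?]] /andP[? ?]]; split; first by rewrite -tE in Ez.
  by split; rewrite /= in_itv /=; apply/andP; split; lra.
have c1' : 0 <= c.1 <= 1 by case/andP: c1 => -> /ltW ->.
have c2' : 0 <= c.2 <= 1 by case/andP: c2 => -> /ltW ->.
have shiftX F : measurable F -> (forall z : R * R, F (z + intv R (1, 0)) <-> F z) ->
    leb2 (X F (- c.1)) = leb2 (X F 0).
  move=> mF perF; rewrite /X -(band_shift fst (intv R (1, 0)) F _ _ mX mF _ perF c1') //.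
  by rewrite addNr.
have shiftY F : measurable F -> (forall z : R * R, F (z + intv R (0, 1)) <-> F z) ->
    leb2 (Y F (- c.2)) = leb2 (Y F 0).
  move=> mF perF; rewrite /Y -(band_shift snd (intv R (0, 1)) F _ _ mY mF _ perF c2') //.
  by rewrite addNr.
have XY F x y : Y (X F x) y = X (Y F y) x by exact: setIAC.
rewrite squareE -shiftY.
- rewrite !XY shiftX //; first by apply: measurableI; [exact: mE | exact: mY].
  move=> z; rewrite /Y /band /= addr0; split=> -[Ez zy]; split=> //.
    exact: (per _ _).1 Ez.
  exact: (per _ _).2 Ez.
- by apply: measurableI; [exact: mE | exact: mX].
- move=> z; rewrite /X /band /= addr0; split=> -[Ez zx]; split=> //.
    exact: (per _ _).1 Ez.
  exact: (per _ _).2 Ez.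
Qed.

Lemma torus_mu_setT : torus_mu setT = 1%E.
Proof.
pose J : set R1 := `[0, 1[%classic.
have l1 : lebesgue_measure J = 1%E.
  by rewrite lebesgue_measure_itv /= lte_fin ltr01 -EFinB subr0.
rewrite torus_muE preimage_setT setTI.
transitivity (lebesgue_measure J * lebesgue_measure J)%E; last by rewrite l1 mule1.
by apply: product_measure1E; exact: measurable_itv.
Qed.

Lemma torus_mu_haar : haar_measure torus_mu.
Proof.
have fin : (torus_mu setT < +oo)%E by rewrite torus_mu_setT ltry.
split.
- by rewrite torus_mu_setT lte_fin.
- exact: torus_mu_invariant.
- move=> K cK; apply: le_lt_trans fin; apply: le_measure => //; rewrite inE.
    by apply: borel_closed; apply: compact_closed cK; exact: torus_hausdorff.
  exact: measurableT.
- by apply: outer_regular => //; exact: torus_open_Fsigma.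
- move=> U oU; apply: inner_regular => //; first exact: torus_open_Fsigma.
    exact: torus_compact.
  exact: torus_hausdorff.
Qed.

(** The preimage of the image of [S] is the union of countably many translates of
    [S]. *)
Lemma torus_mu_null (S : set (R * R)) : compact S -> closed S ->
  leb2 (S : set R2) = 0%E -> torus_mu (proj @` S) = 0%E.
Proof.
move=> cS clS S0; rewrite torus_muE.
have mS := closed_measurable2 R S clS.
pose G n : set R2 := if (unpickle n : option (int * int)) is Some k then
  (fun z : R2 => (z.1 + (intv R (- k)).1, z.2 + (intv R (- k)).2) : R2) @^-1` S else set0.
have mG n : measurable (G n).
  rewrite /G; case: unpickle => [k|]; last exact: measurable0.
  rewrite -[X in measurable X]setTI.
  by have := measurable_translation2 R (intv R (- k)); apply.
have G0 n : leb2 (G n) = 0%E.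
  rewrite /G; case: unpickle => [k|]; last exact: measure0.
  by rewrite leb2_translation.
have mB : measurable (to_borel @^-1` (proj @` S)).
  apply: measurable_preimage_to_borel; apply: borel_closed.
  apply: compact_closed; first exact: torus_hausdorff.
  apply: continuous_compact cS.
  by apply: continuous_subspaceT => x; exact: torus_proj_continuous.
have mBs := measurableI _ _ mB measurable_square.
apply/eqP; rewrite eq_le measure_ge0 ?inE // andbT.
have sub : (to_borel @^-1` (proj @` S)) `&` square `<=` \bigcup_n G n.
  move=> z [[x Sx /torus_proj_eq[k xz]] _].
  exists (pickle (- k)); first exact: I.
  rewrite /G pickleK; change (S (z + intv R (- - k))).
  by rewrite opprK -xz.
apply: (le_trans (measure_sigma_subadditive _ mG mBs sub)).
by rewrite eseries0 // => n _ _; exact: G0.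
Qed.

End torus_measure.

(** * Interiors of convex polygons *)

Definition zcross (p q r : zalpha * zalpha) : zalpha :=
  zmul (q.1 - p.1) (r.2 - p.2) - zmul (q.2 - p.2) (r.1 - p.1).

(** The edge from [p] to [q] lies on a side of the box [b], with [b] on its left. *)
Definition edge_ok (b : box) (p q : zalpha * zalpha) : bool :=
  has (fun d => let c := if d is 0%N then p.2 - q.2 else q.1 - p.1 in
    (zform d p == zform d q) &&
    ((zpos c && zle (zform d p) (lo b d)) ||
     (zpos (- c) && zle (hi b d) (zform d p)))) (iota 0 4).

(** Triangles and quadrilaterals, listed counterclockwise, whose edges all lie on
    sides of the box of their vertices. *)
Definition good_polygon (vs : seq (zalpha * zalpha)) : bool :=
  let b := hull_box vs in
  all (fun v => all (fun d =>
    zle (lo b d) (zform d v) && zle (zform d v) (hi b d)) (iota 0 4)) vs &&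
  match vs with
  | [:: p; q; r] =>
    [&& edge_ok b p q, edge_ok b q r, edge_ok b r p & zpos (zcross p q r)]
  | [:: p; q; r; s] =>
    [&& edge_ok b p q, edge_ok b q r, edge_ok b r s, edge_ok b s p,
        zpos (zcross p q r) & zpos (zcross p r s)]
  | _ => false
  end.

Lemma all_polygons_good : all good_polygon all_polygons.
Proof. by vm_compute. Qed.

Lemma finite_bigcap_open (T : topologicalType) (I : choiceType) (D : set I)
    (f : I -> set T) : finite_set D -> (forall i, D i -> open (f i)) ->
  open (\bigcap_(i in D) f i).
Proof.
move=> fD of_; rewrite -closedC setC_bigcap.
by apply: closed_bigcup => // i Di; rewrite closedC; exact: of_.
Qed.

Section polygons.
Context (R : realType).

Definition segment_closed (A : set (R * R)) :=
  forall x y t, A x -> A y -> 0 <= t <= 1 ->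
    A (t * x.1 + (1 - t) * y.1, t * x.2 + (1 - t) * y.2).

Lemma segment_closedP (A : set (R * R)) : segment_closed A <->
  @convex_set R (R^o * R^o)%type A.
Proof.
split=> [sA x y k|cA x y t Ax Ay /andP[t0 t1]].
  rewrite !inE => Ax Ay; apply: (sA x y k%:num Ax Ay).
  by apply/andP; split; [exact: ge0 | exact: le1].
have := cA x y (Itv01 t0 t1); rewrite !inE => /(_ Ax Ay).
by [].
Qed.

Lemma polygon_segment s : segment_closed (@polygon R s).
Proof.
apply/segment_closedP => x y k; rewrite !inE => Px Py A [cA sA].
by have := cA x y k; rewrite !inE => /(_ (Px _ (conj cA sA)) (Py _ (conj cA sA))).
Qed.

Lemma polygon_vertex (s : seq (R * R)) v : v \in s -> polygon s v.
Proof. by move=> vs A [_ sA]; exact: sA. Qed.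

Lemma polygon_sub (s : seq (R * R)) (A : set (R * R)) :
  segment_closed A -> (forall v, v \in s -> A v) -> polygon s `<=` A.
Proof. by move=> /segment_closedP cA sA x; apply. Qed.

(** The first two points are combined before the third; this divides by the
    weight [x + y], whence the case [z = 1]. *)
Lemma convex3 (A : set (R * R)) p q r x y z : segment_closed A ->
  A p -> A q -> A r -> 0 <= x -> 0 <= y -> 0 <= z -> x + y + z = 1 ->
  A (x * p.1 + y * q.1 + z * r.1, x * p.2 + y * q.2 + z * r.2).
Proof.
move=> sA Ap Aq Ar x0 y0 z0 xyz; have [z1|z1] := eqVneq z 1.
  have -> : x = 0 by lra.
  have -> : y = 0 by lra.
  by rewrite z1 !mul0r !add0r !mul1r; case: r Ar.
have xy0 : 0 < x + y by have : z < 1 by [rewrite lt_neqAle z1 /=; lra]; lra.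
have t01 : 0 <= x / (x + y) <= 1.
  rewrite divr_ge0 ?(ltW xy0) //= ler_pdivrMr //; lra.
have := sA _ _ (x + y) (sA _ _ _ Ap Aq t01) Ar.
have -> : 0 <= x + y <= 1 by apply/andP; split; lra.
move=> /(_ isT) /=; congr A; have zE : z = 1 - (x + y) by lra.
by rewrite zE; congr pair; field; rewrite gt_eqF.
Qed.

Definition rcross (p q z : R * R) : R :=
  (q.1 - p.1) * (z.2 - p.2) - (q.2 - p.2) * (z.1 - p.1).

Lemma rcross_ev p q r : rcross (ev2 R p) (ev2 R q) (ev2 R r) = ev R (zcross p q r).
Proof. by rewrite /rcross /zcross evB !evM !evB. Qed.

(** The barycentric coordinates of [z] are quotients of areas. *)
Lemma triangle_sub (A : set (R * R)) p q r z : segment_closed A ->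
  A p -> A q -> A r -> 0 < rcross p q r -> 0 <= rcross p q z ->
  0 <= rcross q r z -> 0 <= rcross r p z -> A z.
Proof.
move=> sA Ap Aq Ar D pq qr rp; set d := rcross p q r in D.
have dE : rcross q r z + rcross r p z + rcross p q z = d by rewrite /d /rcross; ring.
have := convex3 A p q r (rcross q r z / d) (rcross r p z / d) (rcross p q z / d) sA Ap Aq Ar.
rewrite !divr_ge0 ?(ltW D) // => /(_ isT isT isT).
rewrite -!mulrDl dE divff ?gt_eqF // => /(_ erefl); congr A.
case: z {pq qr rp dE} => z1 z2.
have F (u v w x y t o : R) : u * x + v * y + w * t = o * d ->
    u / d * x + v / d * y + w / d * t = o.
  by move=> E; apply: (mulIf (lt0r_neq0 D)); rewrite -E; field; rewrite gt_eqF.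
by congr pair; apply: F; rewrite /d /rcross /=; ring.
Qed.

(** On an edge where the form [d] is constant, the cross product is proportional
    to the difference of the values of the form. *)
Lemma edge_okP b p q z : edge_ok b p q -> closed_box R b z ->
  0 <= rcross (ev2 R p) (ev2 R q) z.
Proof.
move=> /hasP[d]; rewrite mem_iota add0n /= => d4 /andP[/eqP E sgn] /(_ d d4) /andP[l h].
set c := (X in zpos X && _) in sgn.
have -> : rcross (ev2 R p) (ev2 R q) z = ev R c * (form R d z - ev R (zform d p)).
  have := congr1 (ev R) E; rewrite -!form_ev /c.
  case: d {d4 E sgn l h c} => [|[|[|d]]] /=; rewrite evB /rcross /=.
  - by move=> ->; ring.
  - by move=> ->; ring.
  - move=> E; have -> : ev R q.2 = ev R p.1 + ev R p.2 - ev R q.1 by lra.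
    by ring.
  - move=> E; have -> : ev R q.2 = phi R * ev R p.1 + ev R p.2 - phi R * ev R q.1 by lra.
    by ring.
case/orP: sgn => /andP[/(zpos_gt0 R) c0 /(zle_ev R) le].
  by rewrite mulr_ge0 ?(ltW c0) //; lra.
by rewrite evN in c0; rewrite nmulr_rge0 //; lra.
Qed.

Lemma closed_box_segment b : segment_closed (closed_box R b).
Proof.
move=> x y t bx bY /andP[t0 t1] d d4.
have /andP[xl xh] := bx d d4; have /andP[yl yh] := bY d d4.
have -> : form R d (t * x.1 + (1 - t) * y.1, t * x.2 + (1 - t) * y.2) =
    t * form R d x + (1 - t) * form R d y.
  by case: d {d4 xl xh yl yh} => [|[|[|d]]] /=; ring.
by apply/andP; split; nra.
Qed.

Lemma polygon_sub_box vs : good_polygon vs ->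
  polygon (map (ev2 R) vs) `<=` closed_box R (hull_box vs).
Proof.
move=> /andP[/allP h _]; apply: polygon_sub; first exact: closed_box_segment.
move=> _ /mapP[v vvs ->] d d4; have /allP hv := h v vvs.
have dI : d \in iota 0 4 by rewrite mem_iota.
by have /andP[/(zle_ev R) l /(zle_ev R) h'] := hv d dI; rewrite form_ev l.
Qed.

(** A quadrilateral is cut along its first diagonal. *)
Lemma box_sub_polygon vs : good_polygon vs ->
  closed_box R (hull_box vs) `<=` polygon (map (ev2 R) vs).
Proof.
move=> /andP[_ g] z zb; move: g; set b := hull_box vs in zb *.
have sP := polygon_segment (map (ev2 R) vs).
have vP v : v \in vs -> polygon (map (ev2 R) vs) (ev2 R v).
  by move=> vvs; apply: polygon_vertex; exact: map_f.
case: vs @b zb sP vP => [|p [|q [|r [|s [|]]]]] //= zb sP vP.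
  move=> /and4P[pq qr rp /(zpos_gt0 R)]; rewrite -rcross_ev => D.
  by apply: (triangle_sub _ _ _ _ _ sP _ _ _ D); rewrite ?(edge_okP _ _ _ _ _ zb) //;
    apply: vP; rewrite !inE eqxx ?orbT.
move=> /and5P[pq qr rs sp /andP[/(zpos_gt0 R) + /(zpos_gt0 R)]].
rewrite -!rcross_ev => D1 D2.
have Pp : polygon [:: ev2 R p; ev2 R q; ev2 R r; ev2 R s] (ev2 R p).
  by apply: vP; rewrite !inE eqxx ?orbT.
have Pq : polygon [:: ev2 R p; ev2 R q; ev2 R r; ev2 R s] (ev2 R q).
  by apply: vP; rewrite !inE eqxx ?orbT.
have Pr : polygon [:: ev2 R p; ev2 R q; ev2 R r; ev2 R s] (ev2 R r).
  by apply: vP; rewrite !inE eqxx ?orbT.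
have Ps : polygon [:: ev2 R p; ev2 R q; ev2 R r; ev2 R s] (ev2 R s).
  by apply: vP; rewrite !inE eqxx ?orbT.
have [e1 e2] := (edge_okP _ _ _ _ pq zb, edge_okP _ _ _ _ qr zb).
have [e3 e4] := (edge_okP _ _ _ _ rs zb, edge_okP _ _ _ _ sp zb).
have [pr|pr] := leP 0 (rcross (ev2 R p) (ev2 R r) z).
  exact: (triangle_sub _ _ _ _ _ sP Pp Pr Ps D2).
apply: (triangle_sub _ _ _ _ _ sP Pp Pq Pr D1) => //.
by move: pr; rewrite /rcross; lra.
Qed.

Lemma open_box_open b : open (open_box R b).
Proof.
have -> : open_box R b = \bigcap_(d in `I_4)
    (form R d @^-1` `]ev R (lo b d), ev R (hi b d)[%classic).
  apply/seteqP; split=> z h d d4; first by rewrite /= in_itv /=; exact: h.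
  by have := h d d4; rewrite /= in_itv.
apply: finite_bigcap_open; first exact: finite_II.
move=> d _; apply: open_comp; last exact: itv_open.
by move=> x _; exact: form_continuous.
Qed.

Lemma closed_box_closed b : closed (closed_box R b).
Proof.
have -> : closed_box R b = \bigcap_(d in `I_4)
    (form R d @^-1` `[ev R (lo b d), ev R (hi b d)]%classic).
  apply/seteqP; split=> z h d d4; first by rewrite /= in_itv /=; exact: h.
  by have := h d d4; rewrite /= in_itv.
apply: closed_bigI => d _; apply: closed_comp; last exact: itv_closed.
by move=> x _; exact: form_continuous.
Qed.

(** From a point where a form reaches its bound, small moves along [v] in one of
    the two directions leave the box. *)
Lemma interior_closed_box b : interior (closed_box R b) `<=` open_box R b.
Proof.
move=> z; rewrite /interior => /nbhs_ballP[e /= e0 eb] d d4.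
pose v : R * R := if d is 0%N then (1, 0) else (0, 1).
have fv : form R d v = 1 by rewrite /v; case: d {d4 v} => [|[|[|d]]] /=; ring.
have near t : `|t| < e -> ev R (lo b d) <= form R d z + t <= ev R (hi b d).
  move=> te; have : closed_box R b (z + (t * v.1, t * v.2)).
    apply: eb; split; rewrite /ball /= opprD addrA subrr add0r normrN.
      by rewrite /v; case: d {d4 fv v} => [|d] /=; rewrite ?mulr1 ?mulr0 ?normr0.
    by rewrite /v; case: d {d4 fv v} => [|d] /=; rewrite ?mulr1 ?mulr0 ?normr0.
  by move=> /(_ d d4); rewrite formD formZ fv mulr1.
have := near (e / 2); have := near (- (e / 2)); rewrite normrN gtr0_norm; last by lra.
move=> /(_ ltac:(lra)) /andP[? ?] /(_ ltac:(lra)) /andP[? ?].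
by apply/andP; split; lra.
Qed.

Lemma interior_polygon vs : good_polygon vs ->
  interior (polygon (map (ev2 R) vs)) = open_box R (hull_box vs).
Proof.
move=> g; apply/seteqP; split=> z.
  move=> /(interiorS (polygon_sub_box vs g)); exact: interior_closed_box.
move=> zb; rewrite /interior; apply: (@filterS _ (nbhs z) _ (open_box R (hull_box vs))).
  move=> y yb; apply: box_sub_polygon => // d d4.
  by have /andP[/ltW -> /ltW ->] := yb d d4.
by apply: open_nbhs_nbhs; split => //; exact: open_box_open.
Qed.

End polygons.

(** * The atoms of the partition *)

Definition unit_box (b : box) : bool :=
  [&& zle (0, 0) (lo b 0), zle (hi b 0) (1, 0), zle (0, 0) (lo b 1) & zle (hi b 1) (1, 0)].

Lemma all_polygons_unit : all (fun vs => unit_box (hull_box vs)) all_polygons.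
Proof. by vm_compute. Qed.

Lemma sides_disjoint : all (fun c => all (fun c' =>
  (c == c') || disjoint_box (hull_box (side_vertices c)) (hull_box (side_vertices c')))
  all_sides) all_sides.
Proof. by vm_compute. Qed.

Lemma tops_disjoint : all (fun c => all (fun c' =>
  (c == c') || disjoint_box (hull_box (top_vertices c)) (hull_box (top_vertices c')))
  all_tops) all_tops.
Proof. by vm_compute. Qed.

Lemma mem_all_sides c : c \in all_sides. Proof. by case: c. Qed.
Lemma mem_all_tops c : c \in all_tops. Proof. by case: c. Qed.

Lemma side_polygons c : side_vertices c \in all_polygons.
Proof. by rewrite mem_cat map_f ?mem_all_sides. Qed.
Lemma top_polygons c : top_vertices c \in all_polygons.
Proof. by rewrite mem_cat orbC map_f ?mem_all_tops. Qed.

Section partition.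
Context (R : realType).
Local Notation proj := (\pi_(torus R)%qT : R * R -> torus R).
Local Notation a := (alpha R).

Definition side_box c := hull_box (side_vertices c).
Definition top_box c := hull_box (top_vertices c).

Lemma Y_UE c : Y_U c = proj @` (open_box R (side_box c)).
Proof.
rewrite /Y_U side_verticesE interior_polygon //.
exact: (allP all_polygons_good _ (side_polygons c)).
Qed.

Lemma Z_UE c : Z_U c = proj @` (open_box R (top_box c)).
Proof.
rewrite /Z_U top_verticesE interior_polygon //.
exact: (allP all_polygons_good _ (top_polygons c)).
Qed.

Lemma side_unit c : unit_box (side_box c).
Proof. exact: (allP all_polygons_unit _ (side_polygons c)). Qed.
Lemma top_unit c : unit_box (top_box c).
Proof. exact: (allP all_polygons_unit _ (top_polygons c)). Qed.

Lemma unit_boxP b z : unit_box b -> closed_box R b z ->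
  (0 <= z.1 <= 1) && (0 <= z.2 <= 1).
Proof.
move=> /and4P[/(zle_ev R) l0 /(zle_ev R) h0 /(zle_ev R) l1 /(zle_ev R) h1] zb.
have /andP[? ?] := zb 0%N isT; have /andP[? ?] := zb 1%N isT.
rewrite !ev_int in l0 h0 l1 h1.
by rewrite (le_trans l0) // (le_trans l1) //= (le_trans _ h0) // (le_trans _ h1).
Qed.

Lemma unit_open_boxP b z : unit_box b -> open_box R b z -> (0 < z.1 < 1) && (0 < z.2 < 1).
Proof.
move=> /and4P[/(zle_ev R) l0 /(zle_ev R) h0 /(zle_ev R) l1 /(zle_ev R) h1] zb.
have /andP[? ?] := zb 0%N isT; have /andP[? ?] := zb 1%N isT.
rewrite !ev_int in l0 h0 l1 h1.
by rewrite (le_lt_trans l0) // (le_lt_trans l1) //= (lt_le_trans _ h0) // (lt_le_trans _ h1).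
Qed.

Lemma proj_box b z : unit_box b ->
  (proj @` open_box R b) (proj z) <-> open_box R b (fpart R z.1, fpart R z.2).
Proof.
move=> ub; split=> [[x xb /torus_proj_eq[k xz]]|zb].
  have /andP[x1 x2] := unit_open_boxP b x ub xb.
  have E1 : z.1 = x.1 + (- k.1)%:~R by rewrite xz intrN /= addrK.
  have E2 : z.2 = x.2 + (- k.2)%:~R by rewrite xz intrN /= addrK.
  by rewrite (fpart_eq _ _ _ _ x1 E1) (fpart_eq _ _ _ _ x2 E2); case: x xb {xz x1 x2 E1 E2}.
exists (fpart R z.1, fpart R z.2) => //; apply/torus_proj_eq.
exists (- Num.floor z.1, - Num.floor z.2).
by rewrite /intv /fpart /= !intrN; case: z {zb}.
Qed.

(** The lift of a point to the half-open unit square is unique, and the polygons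
    are pairwise separated by a line in one of the four directions. *)
Lemma Y_U_disjoint c c' (p : torus R) : Y_U c p -> Y_U c' p -> c = c'.
Proof.
have [x ->] := torus_proj_surj R p; rewrite !Y_UE => /proj_box-/(_ (side_unit c)) h.
move=> /proj_box-/(_ (side_unit c')) h'.
have /allP hc := allP sides_disjoint _ (mem_all_sides c).
have /orP[/eqP //|/(disjoint_boxP R) e] := hc _ (mem_all_sides c').
by exfalso; suff : set0 (fpart R x.1, fpart R x.2) by []; rewrite -e.
Qed.

Lemma Z_U_disjoint c c' (p : torus R) : Z_U c p -> Z_U c' p -> c = c'.
Proof.
have [x ->] := torus_proj_surj R p; rewrite !Z_UE => /proj_box-/(_ (top_unit c)) h.
move=> /proj_box-/(_ (top_unit c')) h'.
have /allP hc := allP tops_disjoint _ (mem_all_tops c).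
have /orP[/eqP //|/(disjoint_boxP R) e] := hc _ (mem_all_tops c').
by exfalso; suff : set0 (fpart R x.1, fpart R x.2) by []; rewrite -e.
Qed.

Lemma R_U_image n (A : set (torus R)) : R_U n @` A = translate (orbit R n) A.
Proof. by apply/seteqP; split=> _ [x Ax <-]; exists x; rewrite // R_UE addrC. Qed.

Lemma translateE (h x : torus R) (A : set (torus R)) : translate h A x = A (x - h).
Proof.
apply/propext; split=> [[y Ay <-]|Ax]; first by rewrite addrC addKr.
by exists (x - h) => //; rewrite addrC subrK.
Qed.

Lemma P_U_disjoint u v (p : torus R) : P_U u p -> P_U v p -> u = v.
Proof.
case: u v => [[[ur ut] ul] ub] [[[vr vt] vl] vb]; rewrite /P_U !R_U_image.
move=> [[[u1 u2]]]; rewrite !translateE => u3 u4 [[[v1 v2]]]; rewrite !translateE => v3 v4.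
congr (_, _, _, _).
- exact: Y_U_disjoint u1 v1.
- exact: Z_U_disjoint u2 v2.
- exact: Y_U_disjoint u3 v3.
- exact: Z_U_disjoint u4 v4.
Qed.

Lemma translate_open (h : torus R) (A : set (torus R)) : open A -> open (translate h A).
Proof.
move=> oA; have [c ->] := torus_proj_surj R h.
suff : open (proj @^-1` (translate (proj c) A)) by [].
have -> : proj @^-1` (translate (proj c) A) = (fun z => z - c) @^-1` (proj @^-1` A).
  by apply/funext => z; rewrite /preimage /mkset translateE -torus_projB.
apply: open_comp => // z _; apply: cvgB; [exact: cvg_id | exact: cvg_cst].
Qed.

Lemma translate_closed (h : torus R) (A : set (torus R)) : closed A -> closed (translate h A).
Proof.
move=> cA; rewrite -openC.
have -> : ~` translate h A = translate h (~` A).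
  by apply/funext => x; rewrite /setC /mkset !translateE.
by apply: translate_open; exact: closed_openC.
Qed.

(** Translations are homeomorphisms of the torus. *)
Lemma closure_translate (h x : torus R) (A : set (torus R)) :
  closure (translate h A) x -> closure A (x - h).
Proof.
move=> cx B; rewrite nbhsE => -[B' [oB' B'x] B'B].
have [|y []] := cx (translate h B').
  by apply: open_nbhs_nbhs; split; [exact: translate_open | rewrite translateE].
by rewrite !translateE => Ay B'y; exists (y - h); split => //; exact: B'B.
Qed.

Lemma Y_U_open c : open (Y_U c : set (torus R)).
Proof. by rewrite Y_UE; apply: torus_proj_open; exact: open_box_open. Qed.
Lemma Z_U_open c : open (Z_U c : set (torus R)).
Proof. by rewrite Z_UE; apply: torus_proj_open; exact: open_box_open. Qed.

Lemma P_U_open u : open (P_U u : set (torus R)).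
Proof.
rewrite /P_U !R_U_image; apply: openI; first apply: openI.
- by apply: openI; [exact: Y_U_open | exact: Z_U_open].
- by apply: translate_open; exact: Y_U_open.
- by apply: translate_open; exact: Z_U_open.
Qed.

Lemma in_cell_P_U u z : u \in tiles_U -> in_cell R u z -> P_U u (proj z).
Proof.
move=> uT; rewrite /in_cell; set y := (_, _) => yu.
have yz : proj z = proj y.
  apply/torus_proj_eq; exists (Num.floor z.1, Num.floor z.2).
  by rewrite /y /intv /fpart; case: z {y yu} => z1 z2; rewrite -[RHS]/(_ + _, _ + _) !subrK.
have /and4P[/(subboxP R) s1 /(subboxP R) s2 /(subboxP R) s3 /(subboxP R) s4] :=
  allP cell_sub _ uT.
have sh p : exists k : int, ev R (back_shift p) + a = k%:~R.
  by case: p; [exists 0 | exists 1]; rewrite /ev /=; ring.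
rewrite /P_U yz !R_U_image; split; [split; [split|]|].
- by rewrite Y_UE; exists y => //; exact: s1.
- by rewrite Z_UE; exists y => //; exact: s2.
- rewrite translateE Y_UE; have [k kE] := sh (wide u).
  exists (y + ev2 R (back_shift (wide u), (0, 0))); first exact: s3 (move_boxP _ _ _ _ yu).
  rewrite /orbit -torus_projB; apply/torus_proj_eq; exists (k, 0).
  rewrite /intv /ev2 ev_int -kE mul1r mul0r; clear yz yu s1 s2 s3 s4.
  clearbody y; case: y => y1 y2.
  by rewrite -[LHS]/(_ + _, _ + _) -[RHS]/((y1 - a) + _, (y2 - 0) + _) /=; congr pair; ring.
- rewrite translateE Z_UE; have [k kE] := sh (tall u).
  exists (y + ev2 R ((0, 0), back_shift (tall u))); first exact: s4 (move_boxP _ _ _ _ yu).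
  rewrite /orbit -torus_projB; apply/torus_proj_eq; exists (0, k).
  rewrite /intv /ev2 ev_int -kE mul1r mul0r; clear yz yu s1 s2 s3 s4.
  clearbody y; case: y => y1 y2.
  by rewrite -[LHS]/(_ + _, _ + _) -[RHS]/((y1 - 0) + _, (y2 - a) + _) /=; congr pair; ring.
Qed.

End partition.

(** * Frontiers of the atoms are null *)

Section frontiers.
Context (R : realType).
Local Notation proj := (\pi_(torus R)%qT : R * R -> torus R).
Local Notation a := (alpha R).
Local Notation R2 := (measurableTypeR R * measurableTypeR R)%type.
Local Notation leb2 := (@lebesgue_measure R \x @lebesgue_measure R)%E.
Local Notation null := ((torus_mu R).-negligible).

Lemma frontier_open (T : topologicalType) (A : set T) : open A ->
  frontier A = closure A `\` A.
Proof.
move=> oA; rewrite /frontier; congr (_ `\` _).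
by apply/seteqP; split; [exact: interior_subset | move: oA; rewrite openE].
Qed.

Lemma closed_null (N : set (torus R)) : closed N -> null N <-> torus_mu R N = 0%E.
Proof. by move=> cN; apply: negligibleP; exact: borel_closed. Qed.

Lemma null_sub (A B : set (torus R)) : A `<=` B -> null B -> null A.
Proof. exact: (@negligibleS _ (borel (torus R)) R (torus_mu R)). Qed.

Lemma nullU (A B : set (torus R)) : null A -> null B -> null (A `|` B).
Proof. exact: (@negligibleU _ (borel (torus R)) R (torus_mu R)). Qed.

Lemma null_translate h (N : set (torus R)) : closed N -> null N -> null (translate h N).
Proof.
move=> cN /(closed_null _ cN) N0; apply/closed_null; first exact: translate_closed.
by rewrite -N0; apply: torus_mu_invariant; exact: borel_closed.
Qed.

Lemma square_compact : compact ([set z | 0 <= z.1 <= 1 /\ 0 <= z.2 <= 1] : set (R * R)).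
Proof.
have -> : [set z : R * R | 0 <= z.1 <= 1 /\ 0 <= z.2 <= 1] =
    `[0, 1]%classic `*` `[0, 1]%classic.
  by apply/seteqP; split => z [] /=; rewrite !in_itv /=.
by apply: compact_setX; exact: segment_compact.
Qed.

Definition box_boundary (b : box) : set (R * R) := closed_box R b `\` open_box R b.

Lemma box_boundary_closed b : closed (box_boundary b).
Proof.
rewrite /box_boundary setDE; apply: closedI; first exact: closed_box_closed.
by apply: open_closedC; exact: open_box_open.
Qed.

Lemma unit_closed_compact b (S : set (R * R)) : unit_box b -> closed S ->
  S `<=` closed_box R b -> compact S.
Proof.
move=> ub cS Sb; apply: subclosed_compact cS square_compact _ => z /Sb zb.
by have /andP[] := unit_boxP R b z ub zb.
Qed.

Lemma box_boundary_null b : leb2 (box_boundary b : set R2) = 0%E.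
Proof.
pose L d : set R2 :=
  [set z | form R d z = ev R (lo b d)] `|` [set z | form R d z = ev R (hi b d)].
have mline d c : measurable ([set z | form R d z = c] : set R2).
  apply: closed_measurable2; apply: (@closed_comp _ _ (form R d) [set c]) => //.
  by move=> z _; exact: form_continuous.
have mL d : measurable (L d) by apply: measurableU; exact: mline.
have L0 d : leb2 (L d) = 0%E.
  apply/eqP; rewrite eq_le measure_ge0 andbT.
  apply: (le_trans (measureU2 leb2 (mline d _) (mline d _))).
  rewrite -[leRHS]adde0; apply: leeD; rewrite le_eqVlt; apply/orP; left; apply/eqP;
    exact: line_null.
have mB := closed_measurable2 R _ (box_boundary_closed b).
apply/eqP; rewrite eq_le measure_ge0 andbT.
apply: (le_trans (measure_sigma_subadditive _ mL mB _)); last first.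
  by rewrite eseries0 // => n _ _; exact: L0.
move=> z [zb nz]; apply: contrapT => nL; apply: nz => d d4.
have /andP[l h] := zb d d4; apply/andP; split; rewrite lt_neqAle ?l ?h andbT;
  apply/eqP => E; apply: nL; exists d => //; [left | right]; rewrite /= ?E //.
Qed.

Lemma box_boundary_proj_closed b : unit_box b -> closed (proj @` box_boundary b).
Proof.
move=> ub; apply: compact_closed; first exact: torus_hausdorff.
apply: continuous_compact.
  by apply: continuous_subspaceT => x; exact: torus_proj_continuous.
by apply: (unit_closed_compact b) => //; [exact: box_boundary_closed | move=> z []].
Qed.

Lemma box_boundary_proj_null b : unit_box b -> null (proj @` box_boundary b).
Proof.
move=> ub; apply/closed_null; first exact: box_boundary_proj_closed.
apply: torus_mu_null; [|exact: box_boundary_closed|exact: box_boundary_null].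
by apply: (unit_closed_compact b) => //; [exact: box_boundary_closed | move=> z []].
Qed.

Lemma closure_box_proj b : unit_box b ->
  closure (proj @` open_box R b) `<=` proj @` open_box R b `|` proj @` box_boundary b.
Proof.
move=> ub p cp; have [z zb <-] : (proj @` closed_box R b) p.
  have cl : closed (proj @` closed_box R b).
    apply: compact_closed; first exact: torus_hausdorff.
    apply: continuous_compact.
      by apply: continuous_subspaceT => x; exact: torus_proj_continuous.
    by apply: (unit_closed_compact b) => //; exact: closed_box_closed.
  rewrite ((closure_id _).1 cl); apply: closure_subset cp.
  by apply: image_subset => z zb d d4; have /andP[/ltW -> /ltW ->] := zb d d4.
by have [zo|zo] := pselect (open_box R b z); [left | right]; exists z.
Qed.

(** A boundary point of an intersection of open sets is a boundary point of one
    of them, and the four sets have their boundaries in images of segments. *)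
Lemma frontier_P_U_null u : null (frontier (P_U u : set (torus R))).
Proof.
pose N := (proj @` box_boundary (side_box (right_of u))) `|`
  (proj @` box_boundary (top_box (top_of u))) `|`
  translate (orbit R (1, 0)) (proj @` box_boundary (side_box (left_of u))) `|`
  translate (orbit R (0, 1)) (proj @` box_boundary (top_box (bottom_of u))).
have nN : null N.
  have s1 := box_boundary_proj_null _ (side_unit (right_of u)).
  have s2 := box_boundary_proj_null _ (top_unit (top_of u)).
  have s3 := null_translate (orbit R (1, 0)) _
    (box_boundary_proj_closed _ (side_unit (left_of u)))
    (box_boundary_proj_null _ (side_unit (left_of u))).
  have s4 := null_translate (orbit R (0, 1)) _
    (box_boundary_proj_closed _ (top_unit (bottom_of u)))
    (box_boundary_proj_null _ (top_unit (bottom_of u))).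
  by apply: negligibleU s4; apply: negligibleU s3; exact: negligibleU.
apply: negligibleS nN => p; rewrite frontier_open; last exact: P_U_open.
rewrite /P_U !R_U_image => -[cp nP]; rewrite /N.
have c1 : closure (Y_U (right_of u) : set (torus R)) p by apply: closure_subset cp => x [[[]]].
have c2 : closure (Z_U (top_of u) : set (torus R)) p by apply: closure_subset cp => x [[[]]].
have c3 : closure (Y_U (left_of u) : set (torus R)) (p - orbit R (1, 0)).
  by apply: closure_translate; apply: closure_subset cp => x [[[]]].
have c4 : closure (Z_U (bottom_of u) : set (torus R)) (p - orbit R (0, 1)).
  by apply: closure_translate; apply: closure_subset cp => x [[[]]].
rewrite Y_UE in c1; rewrite Z_UE in c2; rewrite Y_UE in c3; rewrite Z_UE in c4.
have [m1|n1] := closure_box_proj _ (side_unit _) _ c1; last by left; left; left.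
have [m2|n2] := closure_box_proj _ (top_unit _) _ c2; last by left; left; right.
have [m3|n3] := closure_box_proj _ (side_unit _) _ c3; last by left; right; rewrite translateE.
have [m4|n4] := closure_box_proj _ (top_unit _) _ c4; last by right; rewrite translateE.
by exfalso; apply: nP; split; [split; [split|]|]; rewrite ?translateE ?Y_UE ?Z_UE.
Qed.

(** * The parameter of a configuration *)

Lemma D_U_decreasing w m n : (m <= n)%N -> @D_U R w n `<=` D_U w m.
Proof. by move=> mn x xD k /= km; apply: xD => /=; exact: leq_trans mn. Qed.

(** A point that realizes the square of side [2 n + 1] yields, at its centre, a
    point of the set. *)
Lemma D_U_neq0 w n : Omega_U w -> @D_U R w n !=set0.
Proof.
move=> Ow; have [z zP] := Omega_realized R w (- n%:Z, - n%:Z) (n + n).+1 (n + n).+1 Ow.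
exists (proj (z.1 + n%:R * a, z.2 + n%:R * a)) => -[k1 k2] kn.
move: kn => /= kn.
change ((R_U (- (k1, k2)) @` P_U (w (k1, k2))) (proj (z.1 + n%:R * a, z.2 + n%:R * a))).
rewrite R_U_image translateE orbitN opprK.
have [i iE] : exists i : nat, k1 + n%:Z = i%:Z by exists (absz (k1 + n%:Z)%R); lia.
have [j jE] : exists j : nat, k2 + n%:Z = j%:Z by exists (absz (k2 + n%:Z)%R); lia.
have wT : w (k1, k2) \in tiles_U by have [wT _ _] := Ow; exact: wT.
have := zP i j _ _; rewrite /= -iE -jE !addrA ![- n%:Z + _]addrC !subrK.
rewrite /orbit -torus_projD => /(_ _ _)/(in_cell_P_U R _ _ wT) h.
have E : (z.1 + n%:R * a, z.2 + n%:R * a) + (k1%:~R * a, k2%:~R * a) =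
    (z.1 + i%:R * a, z.2 + j%:R * a).
  have iR : i%:R = k1%:~R + n%:R :> R by rewrite -[i%:R]/(i%:Z%:~R) -iE intrD.
  have jR : j%:R = k2%:~R + n%:R :> R by rewrite -[j%:R]/(j%:Z%:~R) -jE intrD.
  by rewrite iR jR -[LHS]/(_ + _, _ + _) /=; congr pair; ring.
by rewrite E; apply: h; lia.
Qed.

(** The sets [D_U w n] generate a proper filter, which clusters at some point of
    the compact torus. *)
Lemma f_UP w : Omega_U w -> forall n, closure (D_U w n) (f_U R w).
Proof.
move=> Ow; suff [x xP] : exists x, (\bigcap_n closure (@D_U R w n)) x.
  have := @xgetPex _ (0 : torus R) (\bigcap_n closure (@D_U R w n)) (ex_intro _ x xP).
  by move=> h n; exact: h.
pose F : set_system (torus R) := filter_from [set: nat] (D_U w).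
have FF : ProperFilter F.
  apply: filter_from_proper; last by move=> n _; exact: D_U_neq0.
  apply: filter_from_filter; first by exists 0%N.
  move=> m n _ _; exists (maxn m n) => // x xD; split.
    exact: D_U_decreasing (leq_maxl m n) _ xD.
  exact: D_U_decreasing (leq_maxr m n) _ xD.
have [x [_ xF]] := torus_compact R F FF (filterT).
exists x => n _ B nB; apply: xF => //; by exists n.
Qed.

End frontiers.

(** * A null circle through a point of the orbit *)

(** The exponents of 5 in the two sides have different parities. *)
Lemma sqr_eq5 (x y : nat) : (x ^ 2 = 5 * y ^ 2)%N -> y = 0%N.
Proof.
move=> E; case: (posnP y) => // y0; have x0 : (0 < x)%N.
  by rewrite -!mulnn in E; case: x E => //; nia.
have := congr1 (logn 5) E; rewrite lognM ?expn_gt0 ?y0 // !lognX (_ : logn 5 5 = 1%N) //; lia.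
Qed.

Section windows.
Context (R : realType).
Local Notation proj := (\pi_(torus R)%qT : R * R -> torus R).
Local Notation a := (alpha R).
Local Notation null := ((torus_mu R).-negligible).
Local Notation orbit := (orbit R).

(** If [alpha = p / q] then [(2 p - 3 q)^2 = 5 q^2]. *)
Lemma alpha_irrational (p q : int) : q%:~R * a = p%:~R -> q = 0.
Proof.
move=> E; have aa := alpha_sqr R.
have : (p * p)%:~R = (3 * p * q - q * q)%:~R :> R.
  by rewrite intrB !intrM -E; ring: aa.
move=> /intr_inj {}E; suff : absz q = 0%N by lia.
apply: (@sqr_eq5 (absz (2 * p - 3 * q)%R)); nia.
Qed.

Lemma orbit_inj : injective orbit.
Proof.
move=> [m1 m2] [n1 n2] /torus_proj_eq[[k1 k2]] E.
have /= E1 := congr1 fst E; have /= E2 := congr1 snd E.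
have q1 : m1 - n1 = 0 by apply: (@alpha_irrational k1); rewrite intrB mulrBl E1; ring.
have q2 : m2 - n2 = 0 by apply: (@alpha_irrational k2); rewrite intrB mulrBl E2; ring.
by congr pair; lia.
Qed.

(** The horizontal circle through the point [orbit n]. *)
Definition circle (n : int * int) : set (torus R) :=
  proj @` [set z | exists k : int, z.2 = n.2%:~R * a + k%:~R].

Lemma circle_proj n z : circle n (proj z) <-> exists k : int, z.2 = n.2%:~R * a + k%:~R.
Proof.
split=> [[x [k xk] /torus_proj_eq[l xz]]|zk]; last by exists z.
exists (k - l.2); rewrite intrB addrA -xk xz /= addrK //.
Qed.

Lemma circle_null n : closed (circle n) /\ null (circle n).
Proof.
pose S : set (R * R) := [set z | 0 <= z.1 <= 1 /\ z.2 = fpart R (n.2%:~R * a)].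
have SE : circle n = proj @` S.
  apply/seteqP; split=> p; have [z ->] := torus_proj_surj R p.
    move=> /circle_proj[k zk]; exists (fpart R z.1, fpart R (n.2%:~R * a)).
      by split => //=; have /andP[-> /ltW ->] := fpart01 R z.1.
    apply/torus_proj_eq; exists (- Num.floor z.1, - (Num.floor (n.2%:~R * a) + k)).
    move: zk; case: z => x y /= ->; rewrite /intv /fpart /= !intrN intrD.
    by rewrite -[RHS]/(_ + _, _ + _) /=; congr pair; ring.
  move=> [x [_ x2] /torus_proj_eq[l xz]]; apply/circle_proj.
  exists (- Num.floor (n.2%:~R * a) - l.2); rewrite intrB intrN addrA.
  by apply/eqP; rewrite eq_sym subr_eq; apply/eqP; rewrite -[RHS]/((z + intv R l).2) -xz x2.
have clS : closed S.
  rewrite (_ : S = (form R 0 @^-1` `[0, 1]%classic) `&`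
      (form R 1 @^-1` [set fpart R (n.2%:~R * a)])).
    apply: closedI.
      apply: (@closed_comp _ _ (form R 0) `[0, 1]%classic); last exact: itv_closed.
      by move=> z _; exact: form_continuous.
    apply: (@closed_comp _ _ (form R 1) [set fpart R (n.2%:~R * a)]) => //.
    by move=> z _; exact: form_continuous.
  by apply/seteqP; split => z [] /=; rewrite in_itv.
have cS : compact S.
  apply: subclosed_compact clS (square_compact R) _ => z [z1 z2]; split => //.
  by rewrite z2; have /andP[-> /ltW ->] := fpart01 R (n.2%:~R * a).
have cl : closed (circle n).
  rewrite SE; apply: compact_closed; first exact: torus_hausdorff.
  apply: continuous_compact cS.
  by apply: continuous_subspaceT => x; exact: torus_proj_continuous.
split=> //; apply/closed_null => //; rewrite SE; apply: torus_mu_null => //.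
apply/eqP; rewrite eq_le measure_ge0 andbT -(line_null R 1 (fpart R (n.2%:~R * a))).
apply: le_measure; rewrite ?inE.
- exact: closed_measurable2.
- apply: closed_measurable2.
  apply: (@closed_comp _ _ (form R 1) [set fpart R (n.2%:~R * a)]) => //.
  by move=> z _; exact: form_continuous.
- by move=> z [].
Qed.

Lemma open_not_circle (O : set (torus R)) n : open O -> O !=set0 -> (O `\` circle n) !=set0.
Proof.
move=> oO [p Op]; have [z zE] := torus_proj_surj R p; subst p.
have : nbhs z (proj @^-1` O).
  by apply: (torus_proj_continuous R z O); exact: open_nbhs_nbhs.
move=> /nbhs_ballP[e /= e0 eO].
have [zc|] := pselect (circle n (proj z)); last by move=> nz; exists (proj z).
pose t := Num.min e 1 / 2.
have [t0 te t1] : [/\ 0 < t, t < e & t < 1].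
  have m0 : 0 < Num.min e 1 by rewrite lt_min e0 ltr01.
  have m1 : Num.min e 1 <= e by rewrite ge_min lexx.
  have m2 : Num.min e 1 <= 1 by rewrite ge_min lexx orbT.
  by rewrite /t; split; lra.
exists (proj (z.1, z.2 + t)); split.
  apply: eO; split; rewrite /ball /= ?subrr ?normr0 //.
  by rewrite opprD addrA subrr add0r normrN gtr0_norm.
move=> /circle_proj[k /= E1]; move/circle_proj: zc => [l E2].
have : (0 : int)%:~R < (k - l)%:~R :> R by rewrite intrB; lra.
have : (k - l)%:~R < (1 : int)%:~R :> R by rewrite intrB; lra.
by rewrite !ltr_int; lia.
Qed.

(** The point at distance [1 / N] from [orbit n] along the circle is off the
    orbit, as [alpha] is irrational. *)
Lemma circle_off_orbit n (B : set (torus R)) : nbhs (orbit n) B ->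
  exists2 p, B p & circle n p /\ ~ range orbit p.
Proof.
move=> nB; pose z : R * R := (n.1%:~R * a, n.2%:~R * a).
have : nbhs z (proj @^-1` B) by exact: (torus_proj_continuous R z B).
move=> /nbhs_ballP[e /= e0 eB].
have [N NP] : exists N : nat, N.+2%:R^-1 < e.
  exists (Num.bound e^-1); rewrite -[ltRHS]invrK ltf_pV2 ?posrE ?invr_gt0 //.
  apply: lt_le_trans (archi_boundP _) _; first by rewrite invr_ge0 ltW.
  by rewrite ler_nat; lia.
exists (proj (z.1 + N.+2%:R^-1, z.2)).
  apply: eB; split; rewrite /ball /= ?subrr ?normr0 //.
  by rewrite opprD addrA subrr add0r normrN gtr0_norm // invr_gt0.
split; first by apply/circle_proj; exists 0; rewrite addr0.
move=> [m _ /torus_proj_eq[k]] /(congr1 fst); rewrite /z /= => E.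
have N0 : N.+2%:R != 0 :> R by rewrite pnatr_eq0.
have E' : N.+2%:R^-1 = (m.1 - n.1)%:~R * a - k.1%:~R.
  by rewrite intrB mulrBl E; ring.
have E2 : (N.+2%:Z * (m.1 - n.1))%:~R * a = (1 + N.+2%:Z * k.1)%:~R.
  have H : 1 + N.+2%:R * k.1%:~R = N.+2%:R * ((m.1 - n.1)%:~R * a).
    have : N.+2%:R * ((m.1 - n.1)%:~R * a - k.1%:~R) = 1 by rewrite -E' mulfV.
    by rewrite mulrBr => /eqP; rewrite subr_eq => /eqP ->.
  by rewrite [in RHS]intrD !intrM -mulrA -[(N.+2%:Z)%:~R]/(N.+2%:R) -H.
have q0 := alpha_irrational _ _ E2.
move: E2; rewrite q0 mul0r => /esym/eqP; rewrite intr_eq0 => /eqP.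
case: k {E E'} => k1 k2 /=; have [k0 | k0] := leP 0 k1; nia.
Qed.

End windows.

(** * Windows *)

Section occurrences.
Context (R : realType) (w : int * int -> tile) (Ow : Omega_U w).
Context (S : set (int * int)) (p : int * int -> tile).
Hypothesis fS : finite_set S.
Local Notation proj := (\pi_(torus R)%qT : R * R -> torus R).
Local Notation null := ((torus_mu R).-negligible).
Local Notation orbit := (orbit R).
Local Notation x := (f_U R w).
Local Notation Q := (occurrences w S p).

Let norm1 (k : int * int) : nat := (absz k.1 + absz k.2)%N.

(** The points whose coding shows the pattern at the origin. *)
Definition pattern_domain : set (torus R) :=
  \bigcap_(k in S) translate (- orbit k) (P_U (p k)).
Definition open_window : set (torus R) := translate (- x) pattern_domain.

Lemma open_windowE g : open_window g = pattern_domain (x + g).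
Proof. by rewrite /open_window translateE opprK addrC. Qed.

Lemma pattern_domainE g : pattern_domain g <-> forall k, S k -> P_U (p k) (g + orbit k).
Proof.
by split=> h k Sk; have := h k Sk; rewrite translateE opprK.
Qed.

Lemma open_window_open : open open_window.
Proof.
apply: translate_open; apply: finite_bigcap_open => // k _.
by apply: translate_open; exact: P_U_open.
Qed.

Lemma closure_cell k : closure (P_U (w k) : set (torus R)) (x + orbit k).
Proof.
rewrite -[orbit k]opprK; apply: closure_translate.
apply: closure_subset (f_UP R w Ow (norm1 k)) => y yD.
by have := yD k (leqnn _); rewrite R_U_image orbitN.
Qed.

(** The orbit of [x] stays in the closures of the atoms of [w], and an atom, being
    open and disjoint from the others, misses their closures. *)
Lemma cell_tile u k : P_U u (x + orbit k) -> u = w k.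
Proof.
move=> uk; have [|y [wy uy]] := closure_cell k (P_U u).
  by apply: open_nbhs_nbhs; split => //; exact: P_U_open.
exact: P_U_disjoint uy wy.
Qed.

Lemma open_window_occurrence n : open_window (orbit n) -> Q n.
Proof.
rewrite open_windowE => /pattern_domainE h k Sk.
by apply/esym/cell_tile; rewrite orbitD addrA; exact: h.
Qed.

(** The point [x] is in the closure of a finite intersection of atoms, not only in
    the intersection of their closures. *)
Lemma occurrence_closure n : Q n -> closure open_window (orbit n).
Proof.
move=> Qn; have [N NP] : exists N, forall k, S k -> (norm1 (n + k)%R <= N)%N.
  have [s sE] := (finite_seqP S).1 fS.
  exists (\max_(k <- s) norm1 (n + k)%R)%N => k; rewrite sE => ks.
  by rewrite (big_rem k ks) leq_maxl.
have c : closure pattern_domain (x + orbit n).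
  rewrite -[orbit n]opprK; apply: closure_translate.
  apply: closure_subset (f_UP R w Ow N) => y yD.
  rewrite translateE opprK; apply/pattern_domainE => k Sk.
  have := yD (n + k) (NP k Sk); rewrite R_U_image translateE orbitN opprK orbitD addrA.
  by rewrite (Qn k Sk).
have -> : orbit n = (x + orbit n) - x by rewrite addrC addKr.
apply: closure_translate; apply: closure_subset c => y yD.
by rewrite translateE open_windowE addrC subrK.
Qed.

(** Where the orbit of [x] hits the boundary of the open window, [w] decides.
    Removing points of [C] off the orbit leaves the model set unchanged; if
    these points accumulate at a point of the orbit, that point joins the
    frontier of the window.  Generic tilings take [C] empty, singular ones a
    circle through an occurrence. *)
Definition adjusted_window (C : set (torus R)) : set (torus R) :=
  (open_window `|` orbit @` Q) `\` (C `\` range orbit).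

Lemma adjusted_window_orbit C n : adjusted_window C (orbit n) <-> Q n.
Proof.
split=> [[[/open_window_occurrence //|[m Qm mn]] _]|Qn].
  by move: Qm; rewrite (orbit_inj R _ _ mn).
split; first by right; exists n.
by move=> [_]; apply; exists n.
Qed.

Lemma frontier_open_window g : frontier open_window g ->
  exists2 k, S k & frontier (P_U (p k) : set (torus R)) (x + g + orbit k).
Proof.
rewrite frontier_open; last exact: open_window_open.
move=> [cg ng]; apply: contrapT => nk; apply: ng.
rewrite open_windowE; apply/pattern_domainE => k Sk; apply: contrapT => nP.
apply: nk; exists k => //; rewrite frontier_open; last exact: P_U_open.
split=> //; rewrite -[x + g]addrC.
have c1 : closure pattern_domain (g - - x) by exact: closure_translate.
rewrite opprK in c1; rewrite -[orbit k]opprK; apply: closure_translate.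
by apply: closure_subset c1 => y yD; exact: yD.
Qed.

Section adjusted.
Context (C : set (torus R)).
Hypotheses (cC : closed C) (nC : null C).
Hypothesis WC : (open_window `\` C) !=set0.
Hypothesis Q0 : Q !=set0.

Lemma interior_adjusted : open_window `\` C `<=` interior (adjusted_window C).
Proof.
have oW : open (open_window `\` C).
  by rewrite setDE; apply: openI; [exact: open_window_open | exact: closed_openC].
rewrite -open_subsetE // => g [Wg nCg]; split; first by left.
by move=> [].
Qed.

Lemma closure_adjusted : closure (adjusted_window C) `<=` closure open_window.
Proof.
rewrite [X in _ `<=` X]((closure_id _).1 (@closed_closure _ open_window)).
apply: closure_subset => g [[Wg|[n Qn <-]] _]; first exact: subset_closure.
exact: occurrence_closure.
Qed.

Lemma frontier_adjusted :
  frontier (adjusted_window C) `<=` frontier open_window `|` C.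
Proof.
move=> g [cg ig]; have [Cg|nCg] := pselect (C g); [by right | left].
rewrite frontier_open; last exact: open_window_open.
split; first exact: closure_adjusted.
by move=> Wg; apply: ig; exact: interior_adjusted.
Qed.

Lemma adjusted_window_window : window (C := torus_scheme R) (adjusted_window C).
Proof.
split.
  rewrite precompactE; apply: subclosed_compact (torus_compact R) _ => //.
  exact: closed_closure.
by have [g Wg] := WC; exists g; exact: interior_adjusted.
Qed.

Lemma adjusted_window_regular : regular_window (C := torus_scheme R) (adjusted_window C).
Proof.
exists (torus_mu R); first exact: torus_mu_haar.
have cF : closed (frontier (adjusted_window C)).
  rewrite /frontier setDE; apply: closedI; first exact: closed_closure.
  by apply: open_closedC; exact: open_interior.
apply: (closed_null R _ cF).1; apply: (null_sub R _ _ frontier_adjusted).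
apply: nullU nC.
have [s sE] := (finite_seqP S).1 fS.
pose F k := translate (- x - orbit k) (frontier (P_U (p k) : set (torus R))).
have nF k : null (F k).
  apply: null_translate; last exact: frontier_P_U_null.
  rewrite /frontier setDE; apply: closedI; first exact: closed_closure.
  by apply: open_closedC; exact: open_interior.
have nU : null (\big[setU/set0]_(k <- s) F k).
  elim: s {sE} => [|k s IH]; first by rewrite big_nil; exact: negligible_set0.
  by rewrite big_cons; exact: nullU.
apply: null_sub nU => g /frontier_open_window[k Sk kg].
rewrite -bigcup_seq; exists k; first by rewrite sE in Sk.
rewrite /F translateE (_ : g - (- x - orbit k) = x + g + orbit k) //.
by rewrite opprB opprK [orbit k + x]addrC addrA [g + x]addrC.
Qed.

Lemma adjusted_window_occurrences :
  @embed R @` Q = translate 0 (curlywedge (C := torus_scheme R) (adjusted_window C)).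
Proof.
rewrite (curlywedgeE R (adjusted_window C)).
apply/seteqP; split=> [_ [n Qn <-]|_ [_ [n An <-] <-]].
  by exists (embed R n); rewrite ?add0r //; exists n => //; apply/adjusted_window_orbit.
by exists n; [exact: (adjusted_window_orbit C n).1 An | rewrite add0r].
Qed.

End adjusted.

Lemma occurrence_tiles k : Q !=set0 -> S k -> p k \in tiles_U.
Proof. by move=> [n Qn] Sk; rewrite -(Qn k Sk); have [wT _ _] := Ow; exact: wT. Qed.

Lemma open_window_neq0 : Q !=set0 -> open_window !=set0.
Proof.
move=> [n Qn]; have [|g [Wg _]] := occurrence_closure n Qn setT; first exact: filterT.
by exists g.
Qed.

(** A point of the orbit on the frontier puts [x] on the translate of the boundary
    of an atom. *)
Lemma generic_adjusted : Q !=set0 -> generic_config R w ->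
  generic_window (C := torus_scheme R) (adjusted_window set0).
Proof.
move=> Q0 gw; apply/seteqP; split=> // g [].
rewrite star_range => -[n _ <-] fr.
have [/frontier_open_window[k Sk fk]|//] := frontier_adjusted set0 (@closed0 _) _ fr.
apply: gw; exists (- (n + k)) => //; exists (x + orbit n + orbit k).
  by exists (p k) => //; exact: occurrence_tiles.
by rewrite R_UE orbitN orbitD -[x + _ + _]addrA addrK.
Qed.

Lemma singular_adjusted n : Q n ->
  singular_window (C := torus_scheme R) (adjusted_window (circle R n)).
Proof.
move=> Qn; exists (orbit n); split; first by rewrite star_range; exists n.
split; first by apply: subset_closure; apply/adjusted_window_orbit.
rewrite /interior => /circle_off_orbit[g [_ nC] gC]; exact: nC.
Qed.

End occurrences.

Theorem theorem4 (R : realType) :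
  exists C : cut_and_project R 2,
  forall (w : int * int -> tile), Omega_U w ->
  forall (S : set (int * int)) (p : int * int -> tile),
    finite_set S -> occurrences w S p !=set0 ->
  exists (t : 'rV[R]_2) (A : set (internal C)),
    [/\ window A,
        @embed R @` occurrences w S p = translate t (curlywedge A),
        regular_window A,
        generic_config R w -> generic_window A &
        singular_config R w -> singular_window A].
Proof.
exists (torus_scheme R) => w Ow S p fS Q0; exists 0.
have W0 := open_window_neq0 R w Ow S p fS Q0.
have oW := open_window_open R w S p fS.
have [sw|gw] := pselect (singular_config R w).
  have [n Qn] := Q0; have [cC nC] := circle_null R n.
  have WC := open_not_circle R _ n oW W0.
  exists (adjusted_window R w S p (circle R n)); split.
  - exact: adjusted_window_window.
  - exact: adjusted_window_occurrences.
  - exact: adjusted_window_regular.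
  - by move=> /(_ sw).
  - by move=> _; exact: singular_adjusted.
have WC : (open_window R w S p `\` set0) !=set0 by rewrite setD0.
have n0 : (torus_mu R).-negligible (set0 : set (torus R)) by exact: negligible_set0.
exists (adjusted_window R w S p set0); split.
- by apply: adjusted_window_window => //; exact: closed0.
- exact: adjusted_window_occurrences.
- by apply: adjusted_window_regular => //; exact: closed0.
- by move=> _; exact: generic_adjusted.
- by move=> /gw.
Qed.
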